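(* For every $\boldsymbol{\theta}\in\mathbb{R}^{m+2(p-1)}$ there exists a positive semidefinite random matrix $W(\boldsymbol{\theta})$ of size $(m+2(p-1))\times(m+2(p-1))$ (a measurable function of the unobserved variables $(x_1,\dots,x_m)$ and of $\boldsymbol{\theta}$) such that for every constant $c>0$, for any sequence of parameters $\{\boldsymbol{\psi}^n\}_{n\ge 1}$ with $\boldsymbol{\psi}^n\in B_c(n,\boldsymbol{\theta})$, for any sequence of random vectors $\{\boldsymbol{\phi}^n\}_{n\ge1}$ with $\boldsymbol{\phi}^n\in R_c(n,\boldsymbol{\theta})$, and for every $\epsilon>0$, $$\mathbb{P}_{\boldsymbol{\psi}^n,(x_1,\dots,x_m)}\left[\left\|\tfrac1n J^n(\boldsymbol{\phi}^n)-W(\boldsymbol{\theta})\right\|\ge\epsilon\right]\to 0,\qquad n\to\infty .$$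
   Context: Model. Fix integers $p\ge2$ (laboratories; laboratory 1 is the reference) and $m\ge2$ (levels), and known positive constants $\sigma^2_{x_j}$ and $\sigma^2_{ij}$ ($i=1,\dots,p$, $j=1,\dots,m$). The parameter is $\boldsymbol{\theta}=(\mu_{x_1},\dots,\mu_{x_m},\alpha_2,\dots,\alpha_p,\beta_2,\dots,\beta_p)^T\in\mathbb{R}^{m+2(p-1)}$; put $\alpha_1=0$, $\beta_1=1$. The unobserved variables $x_j\sim N(\mu_{x_j},\sigma^2_{x_j})$ and the errors $e_{ijk}\sim N(0,\sigma^2_{ij})$ are all mutually independent, and the observations are $Y_{ijk}=\alpha_i+\beta_i x_j+e_{ijk}$, $k=1,\dots,n_i$, $i=1,\dots,p$, $j=1,\dots,m$. Put $n=\sum_{i=1}^p n_i$, and let $\mathbf{Y}^n$ be the vector of all observations. The limit $n\to\infty$ means that $n_i\to\infty$ and $n_i/n\to w_i$ for every $i$, with $w_i>0$ constants. $\mathbb{P}_{\boldsymbol{\theta},(x_1,\dots,x_m)}$ denotes the joint law, under parameter $\boldsymbol{\theta}$, of $(x_1,\dots,x_m)$ and all the observations. $L^n(\boldsymbol{\theta})=\log f_{\mathbf{Y}^n}(\mathbf{Y}^n,\boldsymbol{\theta})$ is the log-likelihood of the observed data (the marginal normal density of $\mathbf{Y}^n$, with $x_1,\dots,x_m$ integrated out), and $J^n(\boldsymbol{\theta})=-\frac{\partial^2L^n(\boldsymbol{\theta})}{\partial\boldsymbol{\theta}\,\partial\boldsymbol{\theta}^T}$. Norms: $\|A\|=\max_{h,s}|A_{hs}|$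 for matrices, $|\mathbf v|=\max_h|v_h|$ for vectors. For $c>0$, $B_c(n,\boldsymbol{\theta})$ is the set of vectors $\boldsymbol{\psi}\in\mathbb{R}^{m+2(p-1)}$ with $\sqrt n\,|\boldsymbol{\psi}-\boldsymbol{\theta}|\le c$, and $R_c(n,\boldsymbol{\theta})$ is the set of random vectors $\boldsymbol{\phi}$ with values in $\mathbb{R}^{m+2(p-1)}$, functions of the observed data $\mathbf{Y}^n$, such that $\sqrt n\,|\boldsymbol{\phi}-\boldsymbol{\theta}|\le c$. *)

(* Defs.v *)
From HB Require Import structures.
From mathcomp Require Import all_boot all_order all_algebra.
From mathcomp Require Import all_classical all_reals all_analysis.

Set Implicit Arguments.
Unset Strict Implicit.
Unset Printing Implicit Defensive.

Import Order.TTheory GRing.Theory Num.Theory.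
Import numFieldNormedType.Exports.

Local Open Scope classical_set_scope.
Local Open Scope ring_scope.

(* There are p = q.+1 laboratories, indexed by 'I_q.+1 with reference ord0, and
   m levels, indexed by 'I_m.  The parameter is the row vector
   (mu_1 .. mu_m, alpha_2 .. alpha_p, beta_2 .. beta_p).  On row vectors and
   matrices, `|_| is the maximum of the absolute values of the entries. *)

Definition pdim (q m : nat) : nat := (m + (q + q))%N.

Definition mu (R : realType) (q m : nat) (theta : 'rV[R]_(pdim q m))
    (j : 'I_m) : R :=
  theta ord0 (lshift (q + q) j).

Definition alpha (R : realType) (q m : nat) (theta : 'rV[R]_(pdim q m))
    (i : 'I_q.+1) : R :=
  if unlift ord0 i is Some l then theta ord0 (rshift m (lshift q l)) else 0.

Definition beta (R : realType) (q m : nat) (theta : 'rV[R]_(pdim q m))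
    (i : 'I_q.+1) : R :=
  if unlift ord0 i is Some l then theta ord0 (rshift m (rshift q l)) else 1.

(* ns i is the number n_i of replicates of laboratory i; an observation index
   consists of a laboratory i, a level j and a replicate k < ns i. *)
Definition obs (q m : nat) (ns : 'I_q.+1 -> nat) : finType :=
  {i : 'I_q.+1 & ('I_m * 'I_(ns i))%type}.

Definition lab (q m : nat) (ns : 'I_q.+1 -> nat) (o : obs m ns) : 'I_q.+1 :=
  tag o.

Definition lev (q m : nat) (ns : 'I_q.+1 -> nat) (o : obs m ns) : 'I_m :=
  (tagged o).1.

Definition size_total (q : nat) (ns : 'I_q.+1 -> nat) : nat :=
  (\sum_i ns i)%N.

(* For a finite family, independence of all finite subfamilies follows from the
   product rule for the whole family, as some of the A k may be setT. *)
Definition mutually_independent (R : realType) (d : measure_display)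
    (T : measurableType d) (P : probability T R) (K : finType)
    (Z : K -> T -> R) : Prop :=
  forall A : K -> set R, (forall k, measurable (A k)) ->
    P (\bigcap_(k in [set: K]) (Z k @^-1` A k)) =
    (\prod_(k : K) P (Z k @^-1` A k))%E.

(* The equality is only required on measurable sets: normal_prob is an integral
   and has no meaning elsewhere.  s is the standard deviation. *)
Definition has_normal_law (R : realType) (d : measure_display)
    (T : measurableType d) (P : probability T R) (X : {RV P >-> R})
    (a s : R) : Prop :=
  forall A : set R, measurable A -> distribution P X A = normal_prob a s A.

Record calibration_model (R : realType) (q m : nat) (sx : 'I_m -> R)
    (se : 'I_q.+1 -> 'I_m -> R) (ns : 'I_q.+1 -> nat)
    (theta : 'rV[R]_(pdim q m)) (d : measure_display) (T : measurableType d)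
    (P : probability T R) (x : 'I_m -> {RV P >-> R})
    (e : obs m ns -> {RV P >-> R}) : Prop := {
  law_x : forall j, has_normal_law (x j) (mu theta j) (sx j) ;
  law_e : forall o, has_normal_law (e o) 0 (se (lab o) (lev o)) ;
  indep_xe : mutually_independent P
    (fun k : 'I_m + obs m ns =>
       match k with inl j => x j : T -> R | inr o => e o : T -> R end) }.

Definition x_vec (R : realType) (m : nat) (T : Type) (x : 'I_m -> T -> R)
    (t : T) : m.-tuple R :=
  [tuple x j t | j < m].

(* The vector of all observations, in the order of the enumeration of the
   observation indices. *)
Definition Y_vec (R : realType) (q m : nat) (ns : 'I_q.+1 -> nat)
    (theta : 'rV[R]_(pdim q m)) (T : Type) (x : 'I_m -> T -> R)
    (e : obs m ns -> T -> R) (t : T) : #|{: obs m ns}|.-tuple R :=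
  [tuple (let o := enum_val l in
          alpha theta (lab o) + beta theta (lab o) * x (lev o) t + e o t)
  | l < #|{: obs m ns}|].

Definition joint_density (R : realType) (q m : nat) (sx : 'I_m -> R)
    (se : 'I_q.+1 -> 'I_m -> R) (ns : 'I_q.+1 -> nat)
    (theta : 'rV[R]_(pdim q m)) (x : m.-tuple R)
    (y : #|{: obs m ns}|.-tuple R) : R :=
  (\prod_(j < m) normal_pdf (mu theta j) (sx j) (tnth x j)) *
  \prod_(l < #|{: obs m ns}|)
    (let o := enum_val l in
     normal_pdf (alpha theta (lab o) + beta theta (lab o) * tnth x (lev o))
       (se (lab o) (lev o)) (tnth y l)).

(* Integral over R^m as an iterated integral, used for nonnegative measurable
   integrands. *)
Fixpoint iterated_integral (R : realType) (m : nat) :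
    (m.-tuple R -> R) -> R :=
  match m return (m.-tuple R -> R) -> R with
  | 0%N => fun f => f [tuple]
  | k.+1 => fun f =>
      Rintegral (@lebesgue_measure R) [set: R]
        (fun u => iterated_integral (fun v : k.-tuple R => f [tuple of u :: v]))
  end.

Definition Y_density (R : realType) (q m : nat) (sx : 'I_m -> R)
    (se : 'I_q.+1 -> 'I_m -> R) (ns : 'I_q.+1 -> nat)
    (y : #|{: obs m ns}|.-tuple R) (theta : 'rV[R]_(pdim q m)) : R :=
  iterated_integral (fun x => joint_density sx se theta x y).

Definition loglik (R : realType) (q m : nat) (sx : 'I_m -> R)
    (se : 'I_q.+1 -> 'I_m -> R) (ns : 'I_q.+1 -> nat)
    (y : #|{: obs m ns}|.-tuple R) (theta : 'rV[R]_(pdim q m)) : R :=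
  ln (Y_density sx se y theta).

Definition partial_deriv (R : realType) (k : nat) (h : 'I_k)
    (f : 'rV[R]_k -> R) (theta : 'rV[R]_k) : R :=
  'D_(delta_mx ord0 h) f theta.

Definition J (R : realType) (q m : nat) (sx : 'I_m -> R)
    (se : 'I_q.+1 -> 'I_m -> R) (ns : 'I_q.+1 -> nat)
    (y : #|{: obs m ns}|.-tuple R) (theta : 'rV[R]_(pdim q m)) :
    'M[R]_(pdim q m) :=
  \matrix_(h, s) - partial_deriv h (partial_deriv s (loglik sx se y)) theta.

Definition psd (R : realType) (k : nat) (A : 'M[R]_k) : Prop :=
  A^T = A /\ forall v : 'rV[R]_k, 0 <= (v *m A *m v^T) ord0 ord0.

Definition measurable_rV (R : realType) (d : measure_display)
    (T : measurableType d) (k : nat) (f : T -> 'rV[R]_k) : Prop :=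
  forall h, measurable_fun [set: T] (fun t => f t ord0 h).

(* Joint measurability in (theta, x); theta is passed as a tuple because tuples,
   unlike row vectors, carry the product sigma-algebra in the library. *)
Definition measurable_W (R : realType) (k m : nat)
    (W : 'rV[R]_k -> m.-tuple R -> 'M[R]_k) : Prop :=
  forall h s, measurable_fun [set: k.-tuple R * m.-tuple R]
    (fun z : k.-tuple R * m.-tuple R =>
       W (\row_l tnth z.1 l) z.2 h s).

Definition large_samples (R : realType) (q : nat) (w : 'I_q.+1 -> R)
    (ns : nat -> 'I_q.+1 -> nat) : Prop :=
  forall i, (fun r => ns r i) @ \oo --> \oo /\
    (fun r => (ns r i)%:R / (size_total (ns r))%:R : R) @ \oo --> w i.

Definition in_B (R : realType) (k : nat) (c : R) (n : nat)
    (theta psi : 'rV[R]_k) : Prop :=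
  Num.sqrt (n%:R : R) * `|psi - theta| <= c.

Definition in_R (R : realType) (k N : nat) (c : R) (n : nat)
    (theta : 'rV[R]_k) (phi : N.-tuple R -> 'rV[R]_k) : Prop :=
  measurable_rV phi /\ forall y, in_B c n theta (phi y).

(* Main.v *)
Require Import Defs.
From HB Require Import structures.
From mathcomp Require Import all_boot all_order all_algebra.
From mathcomp Require Import all_classical all_reals all_analysis.
From mathcomp Require Import measurable_realfun.
From mathcomp Require Import ring lra.

Import Order.TTheory GRing.Theory Num.Theory.
Import numFieldNormedType.Exports.

Local Open Scope classical_set_scope.
Local Open Scope ring_scope.

(** Why the theorem holds.  Given the observations, the joint density of the
    levels factors over j, and the factor of level j is, as a function of
    u = x_j, a constant times exp (- (a u^2 - 2 b u + d) / 2), where a, b, d are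
    polynomials in the parameter.  Apart from the sum of the squares of the
    observations in d, which does not involve the parameter, they depend on the
    data only through the replicate numbers n_i and the cell sums S_ij.
    Integrating out u gives an explicit log-likelihood (loglikE), up to a
    constant the sum over j of
    - (ln a) / 2 - d / 2 + b^2 / (2 a),
    hence an explicit rational expression for J (J_obs_infoE).  Every term of
    that expression except those coming from ln a is homogeneous of degree one
    in (prior weight, n_i, S_ij), so J / n is the same expression evaluated at
    (1/n, n_i/n, S_ij/n) with the terms from ln a divided by n (obs_infoZ).

    Under the parameter psi^n, S_ij / n is
    (n_i/n) (alpha_i + beta_i x_j) plus a noise average that tends to 0 by
    Chebyshev's inequality; n_i / n tends to w_i; and psi^n, phi^n are within
    c / sqrt n of theta.  So W(theta) is the same expression with prior weight 0
    at n_i/n = w_i and S_ij/n = w_i (alpha_i + beta_i x_j).  There the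
    expression simplifies to a sum over j of a weighted Gram matrix minus a
    rank-one term (limit_infoE), which is positive semidefinite by the
    Cauchy-Schwarz inequality.

    The limit W(theta) is random and unbounded, so products of approximations
    are only controlled where the x_j are bounded.  The argument is therefore
    split: on the event that every |x_j - mu_j| is below K and every noise sum
    is small, all approximations are uniform and deterministic (unif_approx and
    its closure under the field operations); the complement of that event has
    probability at most (constant / K^2) + o(1), from second moments of normal
    variables.  These need the integral of a function against a law with a
    density, and the fact that independent variables are uncorrelated, which
    comes from uniqueness of the product measure and Fubini's theorem. *)

Set Implicit Arguments.
Unset Strict Implicit.
Unset Printing Implicit Defensive.

(** * Derivatives along lines *)

Section DirectionalDerivatives.
Context {R : realType}.

(** Directional derivatives of functions of the parameter are computed on one
    real variable, where the rules for ln and for the inverse are stated. *)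
Lemma derive_along_line (k : nat) (f : 'rV[R]_k -> R) (x v : 'rV[R]_k)
    (df : R) :
  is_derive (0 : R) 1 (fun t : R => f (x + t *: v)) df -> 'D_v f x = df.
Proof.
move=> [_ <-]; rewrite /derive.
apply: (congr1 (fun g : R -> R => lim (g @ 0^'))); apply/funext => h /=.
by rewrite addr0 scale0r addr0 [h%:A]mulr1 (addrC x).
Qed.

Lemma is_derive_quadratic (a b c : R) :
  is_derive (0 : R) 1 (fun t : R => a + t * b + t ^+ 2 * c) b.
Proof.
have -> : (fun t : R => a + t * b + t ^+ 2 * c) =
  cst a + id * cst b + id * id * cst c.
  by apply/funext => t; rewrite /GRing.exp/=.
have Hi := @is_derive_id R R (0 : R) 1.
have Hc (r : R) := @is_derive_cst R R R r (0 : R) 1.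
apply: (is_derive_eq (is_deriveD (is_deriveD (Hc a) (is_deriveM Hi (Hc b)))
  (is_deriveM (is_deriveM Hi Hi) (Hc c)))).
by rewrite !fctE /GRing.scale /=; ring.
Qed.

(** The function is the logarithm, up to an additive constant, of the integral
    of exp (- (a x^2 - 2 b x + d) / 2) over x. *)
Lemma is_derive_profile (a b d : R -> R) (t da db dd : R) :
  0 < a t -> is_derive t 1 a da -> is_derive t 1 b db -> is_derive t 1 d dd ->
  is_derive t 1 (fun u => - ln (a u) / 2 - d u / 2 + b u ^+ 2 / (2 * a u))
    (- da / (2 * a t) - dd / 2 + b t * db / a t
      - b t ^+ 2 * da / (2 * a t ^+ 2)).
Proof.
move=> a0 Ha Hb Hd.
have HV := is_deriveV (lt0r_neq0 a0) Ha.
have Hl : is_derive (a t) 1 (@ln R) (a t)^-1 by exact: is_derive1_ln.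
have HL := is_derive1_comp Hl Ha.
have -> : (fun u => - ln (a u) / 2 - d u / 2 + b u ^+ 2 / (2 * a u)) =
  (@ln R \o a) * cst (- 2^-1) + d * cst (- 2^-1)
  + b * b * (fun u => (a u)^-1) * cst (2^-1).
  by apply/funext => u; rewrite !fctE /= expr2 invfM; ring.
have Hc (r : R) := @is_derive_cst R R R r t 1.
have H := is_deriveD (is_deriveD (is_deriveM HL (Hc (- 2^-1)))
  (is_deriveM Hd (Hc (- 2^-1))))
  (is_deriveM (is_deriveM (is_deriveM Hb Hb) HV) (Hc (2^-1))).
apply: (is_derive_eq H).
rewrite !fctE /GRing.scale /=.
have a1 := lt0r_neq0 a0.
by field.
Qed.

Lemma is_derive_profile_gradient (a a1 b b1 d1 : R -> R)
    (t da da1 db db1 dd1 : R) :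
  0 < a t -> is_derive t 1 a da -> is_derive t 1 a1 da1 ->
  is_derive t 1 b db -> is_derive t 1 b1 db1 -> is_derive t 1 d1 dd1 ->
  is_derive t 1 (fun u => - a1 u / (2 * a u) - d1 u / 2 + b u * b1 u / a u
      - b u ^+ 2 * a1 u / (2 * a u ^+ 2))
    (- ((da1 / a t - da * a1 t / a t ^+ 2) / 2 + dd1 / 2
      - ((db * b1 t + b t * db1) / a t
         - b t * (db * a1 t + b1 t * da) / a t ^+ 2
         - b t ^+ 2 * da1 / (2 * a t ^+ 2) + b t ^+ 2 * da * a1 t / a t ^+ 3))).
Proof.
move=> a0 Ha Ha1 Hb Hb1 Hd.
have HV := is_deriveV (lt0r_neq0 a0) Ha.
have -> : (fun u => - a1 u / (2 * a u) - d1 u / 2 + b u * b1 u / a u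
      - b u ^+ 2 * a1 u / (2 * a u ^+ 2)) =
  a1 * (fun u => (a u)^-1) * cst (- 2^-1) + d1 * cst (- 2^-1)
  + b * b1 * (fun u => (a u)^-1)
  + b * b * a1 * ((fun u => (a u)^-1) * (fun u => (a u)^-1)) * cst (- 2^-1).
  by apply/funext => u; rewrite !fctE /= !invfM; ring.
have Hc (r : R) := @is_derive_cst R R R r t 1.
have H := is_deriveD (is_deriveD (is_deriveD
  (is_deriveM (is_deriveM Ha1 HV) (Hc (- 2^-1))) (is_deriveM Hd (Hc (- 2^-1))))
  (is_deriveM (is_deriveM Hb Hb1) HV))
  (is_deriveM (is_deriveM (is_deriveM (is_deriveM Hb Hb) Ha1)
    (is_deriveM HV HV)) (Hc (- 2^-1))).
apply: (is_derive_eq H).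
rewrite !fctE /GRing.scale /=.
have an := lt0r_neq0 a0.
by field.
Qed.

End DirectionalDerivatives.

(** * The coefficients of the exponent and the profile *)

Lemma sum_quadratic (R : fieldType) (I : finType) (t c0 c1 c2 c3 : R)
    (F G H K : I -> R) :
  c0 = c1 + t * c2 + t ^+ 2 * (c3 / 2) ->
  (forall i, F i = G i + t * H i + t ^+ 2 * (K i / 2)) ->
  c0 + \sum_i F i =
  (c1 + \sum_i G i) + t * (c2 + \sum_i H i) + t ^+ 2 * ((c3 + \sum_i K i) / 2).
Proof.
move=> -> E; rewrite (eq_bigr _ (fun i _ => E i)) !big_split/=.
rewrite -!mulr_sumr -mulr_suml; ring.
Qed.

Lemma sum_affine (R : fieldType) (I : finType) (t c0 c1 c2 : R)
    (F G H : I -> R) :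
  c0 = c1 + t * c2 -> (forall i, F i = G i + t * H i) ->
  c0 + \sum_i F i = (c1 + \sum_i G i) + t * (c2 + \sum_i H i).
Proof.
move=> -> E; rewrite (eq_bigr _ (fun i _ => E i)) !big_split/=.
rewrite -!mulr_sumr; ring.
Qed.

Section ProfileLikelihood.
Context {R : realType} {q m : nat}.
Variables (sx : 'I_m -> R) (se : 'I_q.+1 -> 'I_m -> R).
Hypotheses (hsx : forall j, 0 < sx j) (hse : forall i j, 0 < se i j).
Implicit Types (theta u v : 'rV[R]_(pdim q m)) (k tau : R)
  (rho : 'I_q.+1 -> R) (S : 'I_q.+1 -> 'I_m -> R).

(** The linear part of beta, which is affine because beta is 1 at the reference
    laboratory. *)
Definition slope v (i : 'I_q.+1) : R :=
  if unlift ord0 i is Some l then v ord0 (rshift m (rshift q l)) else 0.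

Lemma mu_line theta v (t : R) j :
  mu (theta + t *: v) j = mu theta j + t * mu v j.
Proof. by rewrite /mu !mxE. Qed.

Lemma alpha_line theta v (t : R) i :
  alpha (theta + t *: v) i = alpha theta i + t * alpha v i.
Proof.
by rewrite /alpha; case: unliftP => [l _|_]; rewrite ?mxE// mulr0 addr0.
Qed.

Lemma beta_line theta v (t : R) i :
  beta (theta + t *: v) i = beta theta i + t * slope v i.
Proof.
by rewrite /beta /slope; case: unliftP => [l _|_]; rewrite ?mxE// mulr0 addr0.
Qed.

(** [quad_coef], [lin_coef] and [cst_coef] are the coefficients a, b and d of the
    exponent - (a u^2 - 2 b u + d) / 2 of level j, the squares of the
    observations being left out of d since they do not involve the parameter.
    The prior weight [k], the replicate numbers [rho] and the cell sums [S] are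
    kept as free variables: the likelihood has [k] = 1, integer [rho] and the
    sums themselves, its rescaling by n has all three divided by n, and the
    limit has [k] = 0.  The suffix 1 marks the derivative in one direction, the
    suffix 2 the second derivative in two directions. *)
Definition quad_coef k rho theta j : R :=
  k * (sx j ^+ 2)^-1 + \sum_i rho i * (se i j ^+ 2)^-1 * beta theta i ^+ 2.

Definition quad_coef1 rho theta v j : R :=
  \sum_i 2 * rho i * (se i j ^+ 2)^-1 * beta theta i * slope v i.

Definition quad_coef2 rho u v j : R :=
  \sum_i 2 * rho i * (se i j ^+ 2)^-1 * slope u i * slope v i.

Definition lin_coef k rho S theta j : R :=
  k * mu theta j * (sx j ^+ 2)^-1 +
  \sum_i (se i j ^+ 2)^-1 * beta theta i * (S i j - rho i * alpha theta i).

Definition lin_coef1 k rho S theta v j : R :=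
  k * mu v j * (sx j ^+ 2)^-1 +
  \sum_i (se i j ^+ 2)^-1 * (slope v i * (S i j - rho i * alpha theta i)
                             - rho i * beta theta i * alpha v i).

Definition lin_coef2 rho u v j : R :=
  \sum_i - (se i j ^+ 2)^-1 * rho i *
    (slope u i * alpha v i + slope v i * alpha u i).

Definition cst_coef k rho S theta j : R :=
  k * mu theta j ^+ 2 * (sx j ^+ 2)^-1 +
  \sum_i (se i j ^+ 2)^-1 *
    (rho i * alpha theta i ^+ 2 - 2 * alpha theta i * S i j).

Definition cst_coef1 k rho S theta v j : R :=
  2 * k * mu theta j * mu v j * (sx j ^+ 2)^-1 +
  \sum_i (se i j ^+ 2)^-1 *
    (2 * rho i * alpha theta i * alpha v i - 2 * alpha v i * S i j).

Definition cst_coef2 k rho u v j : R :=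
  2 * k * mu u j * mu v j * (sx j ^+ 2)^-1 +
  \sum_i 2 * rho i * (se i j ^+ 2)^-1 * alpha u i * alpha v i.

Definition profile k rho S theta : R :=
  \sum_j (- ln (quad_coef k rho theta j) / 2 - cst_coef k rho S theta j / 2 +
          lin_coef k rho S theta j ^+ 2 / (2 * quad_coef k rho theta j)).

Definition profile1 k rho S theta v : R :=
  \sum_j (- quad_coef1 rho theta v j / (2 * quad_coef k rho theta j)
     - cst_coef1 k rho S theta v j / 2
     + lin_coef k rho S theta j * lin_coef1 k rho S theta v j
         / quad_coef k rho theta j
     - lin_coef k rho S theta j ^+ 2 * quad_coef1 rho theta v j /
         (2 * quad_coef k rho theta j ^+ 2)).

(** Minus the second derivative of one summand of [profile], from
    [is_derive_profile_gradient].  The factor [tau] isolates the terms that come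
    from the logarithm, the only ones that do not scale like the others. *)
Definition obs_info_level tau k rho S theta u v j : R :=
  let a := quad_coef k rho theta j in let b := lin_coef k rho S theta j in
  let au := quad_coef1 rho theta u j in let av := quad_coef1 rho theta v j in
  let bu := lin_coef1 k rho S theta u j in
  let bv := lin_coef1 k rho S theta v j in
  let auv := quad_coef2 rho u v j in let buv := lin_coef2 rho u v j in
  tau * ((auv / a - au * av / a ^+ 2) / 2) + cst_coef2 k rho u v j / 2
  - ((bu * bv + b * buv) / a - b * (bu * av + bv * au) / a ^+ 2
     - b ^+ 2 * auv / (2 * a ^+ 2) + b ^+ 2 * au * av / a ^+ 3).

Definition obs_info tau k rho S theta u v : R :=
  \sum_j obs_info_level tau k rho S theta u v j.

Lemma quad_coef_gt0 k rho theta j :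
  0 < k -> (forall i, 0 <= rho i) -> 0 < quad_coef k rho theta j.
Proof.
move=> k0 r0; apply: ltr_pwDl; first by rewrite mulr_gt0// invr_gt0 exprn_gt0.
apply: sumr_ge0 => i _; apply: mulr_ge0; last exact: sqr_ge0.
by apply: mulr_ge0 => //; rewrite invr_ge0 sqr_ge0.
Qed.

Lemma quad_coef_line k rho theta v (t : R) j :
  quad_coef k rho (theta + t *: v) j =
  quad_coef k rho theta j + t * quad_coef1 rho theta v j
  + t ^+ 2 * (quad_coef2 rho v v j / 2).
Proof.
rewrite -[quad_coef1 _ _ _ _]add0r -[quad_coef2 _ _ _ _]add0r.
apply: sum_quadratic => [|i]; first by ring.
by rewrite beta_line; field; exact: lt0r_neq0.
Qed.

Lemma quad_coef1_line rho theta u v (t : R) j :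
  quad_coef1 rho (theta + t *: u) v j =
  quad_coef1 rho theta v j + t * quad_coef2 rho u v j.
Proof.
rewrite -[quad_coef1 _ _ _ _]add0r -[quad_coef1 rho theta v j]add0r.
rewrite -[quad_coef2 _ _ _ _]add0r.
apply: sum_affine => [|i]; first by ring.
by rewrite beta_line; ring.
Qed.

Lemma lin_coef_line k rho S theta v (t : R) j :
  lin_coef k rho S (theta + t *: v) j =
  lin_coef k rho S theta j + t * lin_coef1 k rho S theta v j
  + t ^+ 2 * (lin_coef2 rho v v j / 2).
Proof.
rewrite -[lin_coef2 _ _ _ _]add0r.
apply: sum_quadratic => [|i]; first by rewrite mu_line; ring.
by rewrite beta_line alpha_line; field; exact: lt0r_neq0.
Qed.

Lemma lin_coef1_line k rho S theta u v (t : R) j :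
  lin_coef1 k rho S (theta + t *: u) v j =
  lin_coef1 k rho S theta v j + t * lin_coef2 rho u v j.
Proof.
rewrite -[lin_coef2 _ _ _ _]add0r.
apply: sum_affine => [|i]; first by ring.
by rewrite beta_line alpha_line; ring.
Qed.

Lemma cst_coef_line k rho S theta v (t : R) j :
  cst_coef k rho S (theta + t *: v) j =
  cst_coef k rho S theta j + t * cst_coef1 k rho S theta v j
  + t ^+ 2 * (cst_coef2 k rho v v j / 2).
Proof.
apply: sum_quadratic => [|i]; first by rewrite mu_line; field; exact: lt0r_neq0.
by rewrite alpha_line; field; exact: lt0r_neq0.
Qed.

Lemma cst_coef1_line k rho S theta u v (t : R) j :
  cst_coef1 k rho S (theta + t *: u) v j =
  cst_coef1 k rho S theta v j + t * cst_coef2 k rho u v j.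
Proof.
apply: sum_affine => [|i]; first by rewrite mu_line; ring.
by rewrite alpha_line; ring.
Qed.

Let is_derive_line (f : 'rV[R]_(pdim q m) -> R) theta v a b :
  (forall t, f (theta + t *: v) = f theta + t * a + t ^+ 2 * b) ->
  is_derive (0 : R) 1 (fun t : R => f (theta + t *: v)) a.
Proof. by move=> /funext ->; exact: is_derive_quadratic. Qed.

Let is_derive_aff (f : 'rV[R]_(pdim q m) -> R) theta v a :
  (forall t, f (theta + t *: v) = f theta + t * a) ->
  is_derive (0 : R) 1 (fun t : R => f (theta + t *: v)) a.
Proof.
by move=> E; apply: (@is_derive_line _ _ _ _ 0) => t; rewrite E mulr0 addr0.
Qed.

Lemma derive_profile k rho S theta v (C : R) :
  0 < k -> (forall i, 0 <= rho i) ->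
  'D_v (fun x => C + profile k rho S x) theta = profile1 k rho S theta v.
Proof.
move=> k0 r0; apply: derive_along_line.
pose f j (t : R) := - ln (quad_coef k rho (theta + t *: v) j) / 2
  - cst_coef k rho S (theta + t *: v) j / 2 +
  lin_coef k rho S (theta + t *: v) j ^+ 2
    / (2 * quad_coef k rho (theta + t *: v) j).
have z : theta + 0 *: v = theta by rewrite scale0r addr0.
suff H j : is_derive (0 : R) 1 (f j)
    (- quad_coef1 rho theta v j / (2 * quad_coef k rho theta j)
     - cst_coef1 k rho S theta v j / 2
     + lin_coef k rho S theta j * lin_coef1 k rho S theta v j
         / quad_coef k rho theta j
     - lin_coef k rho S theta j ^+ 2 * quad_coef1 rho theta v j /
         (2 * quad_coef k rho theta j ^+ 2)).
  rewrite (_ : (fun t => _) = cst C + \sum_j f j); last first.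
    by apply/funext => t; rewrite fctE fct_sumE.
  rewrite -[profile1 _ _ _ _ _]add0r.
  exact: (is_deriveD (is_derive_cst C _ _) (is_derive_sum H)).
have a0 : 0 < quad_coef k rho (theta + 0 *: v) j by exact: quad_coef_gt0.
have Ha := @is_derive_line (quad_coef k rho ^~ j) _ _ _ _
  (fun t => quad_coef_line k rho theta v t j).
have Hb := @is_derive_line (lin_coef k rho S ^~ j) _ _ _ _
  (fun t => lin_coef_line k rho S theta v t j).
have Hd := @is_derive_line (cst_coef k rho S ^~ j) _ _ _ _
  (fun t => cst_coef_line k rho S theta v t j).
have := is_derive_profile
  (a := fun t => quad_coef k rho (theta + t *: v) j) a0 Ha Hb Hd.
by rewrite !z.
Qed.

Lemma derive_profile1 k rho S theta u v :
  0 < k -> (forall i, 0 <= rho i) ->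
  'D_u (fun x => profile1 k rho S x v) theta = - obs_info 1 k rho S theta u v.
Proof.
move=> k0 r0; apply: derive_along_line.
have z : theta + 0 *: u = theta by rewrite scale0r addr0.
pose f j (t : R) :=
  let a := quad_coef k rho (theta + t *: u) j in
  let b := lin_coef k rho S (theta + t *: u) j in
  let av := quad_coef1 rho (theta + t *: u) v j in
  let bv := lin_coef1 k rho S (theta + t *: u) v j in
  - av / (2 * a) - cst_coef1 k rho S (theta + t *: u) v j / 2
  + b * bv / a - b ^+ 2 * av / (2 * a ^+ 2).
suff H j : is_derive (0 : R) 1 (f j) (- obs_info_level 1 k rho S theta u v j).
  rewrite (_ : (fun t => _) = \sum_j f j); last first.
    by apply/funext => t; rewrite fct_sumE.
  by rewrite /obs_info -sumrN; exact: is_derive_sum.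
have a0 : 0 < quad_coef k rho (theta + 0 *: u) j by exact: quad_coef_gt0.
have Ha := @is_derive_line (quad_coef k rho ^~ j) _ _ _ _
  (fun t => quad_coef_line k rho theta u t j).
have Ha1 := @is_derive_aff (fun x => quad_coef1 rho x v j) _ _ _
  (fun t => quad_coef1_line rho theta u v t j).
have Hb := @is_derive_line (lin_coef k rho S ^~ j) _ _ _ _
  (fun t => lin_coef_line k rho S theta u t j).
have Hb1 := @is_derive_aff (fun x => lin_coef1 k rho S x v j) _ _ _
  (fun t => lin_coef1_line k rho S theta u v t j).
have Hd := @is_derive_aff (fun x => cst_coef1 k rho S x v j) _ _ _
  (fun t => cst_coef1_line k rho S theta u v t j).
have := is_derive_profile_gradient
  (a := fun t => quad_coef k rho (theta + t *: u) j) a0 Ha Ha1 Hb Hb1 Hd.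
by rewrite !z /obs_info_level mul1r.
Qed.

End ProfileLikelihood.

(** * The limiting information *)

Section LimitingInformation.
Context {R : realType} {q m : nat}.
Variables (sx : 'I_m -> R) (se : 'I_q.+1 -> 'I_m -> R).
Hypotheses (hsx : forall j, 0 < sx j) (hse : forall i j, 0 < se i j).
Implicit Types (theta u v : 'rV[R]_(pdim q m)) (k tau : R)
  (rho : 'I_q.+1 -> R) (S : 'I_q.+1 -> 'I_m -> R).

(** The coefficients a, b, d and their derivatives are linear in [k], [rho] and
    [S] jointly, and the terms without [tau] are homogeneous of degree one in
    them; those with [tau] have degree zero. *)
Lemma obs_infoZ tau k rho S theta u v (c : R) :
  0 < c -> 0 < k -> (forall i, 0 <= rho i) ->
  obs_info sx se (c * tau) (c * k) (fun i => c * rho i) (fun i j => c * S i j)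
    theta u v = c * obs_info sx se tau k rho S theta u v.
Proof.
move=> c0 k0 r0; rewrite /obs_info mulr_sumr; apply: eq_bigr => j _.
have a0 := lt0r_neq0 (quad_coef_gt0 se hsx theta j k0 r0).
have c1 := lt0r_neq0 c0.
have Ea : quad_coef sx se (c * k) (fun i => c * rho i) theta j =
    c * quad_coef sx se k rho theta j.
  rewrite /quad_coef mulrDr mulr_sumr -mulrA; congr +%R.
  by apply: eq_bigr => i _; ring.
have E1 w : quad_coef1 se (fun i => c * rho i) theta w j =
    c * quad_coef1 se rho theta w j.
  by rewrite /quad_coef1 mulr_sumr; apply: eq_bigr => i _; ring.
have E2 : quad_coef2 se (fun i => c * rho i) u v j =
    c * quad_coef2 se rho u v j.
  by rewrite /quad_coef2 mulr_sumr; apply: eq_bigr => i _; ring.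
have Eb : lin_coef sx se (c * k) (fun i => c * rho i)
    (fun i j => c * S i j) theta j =
    c * lin_coef sx se k rho S theta j.
  rewrite /lin_coef mulrDr mulr_sumr; congr +%R; first by ring.
  by apply: eq_bigr => i _; ring.
have Eb1 w : lin_coef1 sx se (c * k) (fun i => c * rho i) (fun i j => c * S i j)
    theta w j = c * lin_coef1 sx se k rho S theta w j.
  rewrite /lin_coef1 mulrDr mulr_sumr; congr +%R; first by ring.
  by apply: eq_bigr => i _; ring.
have Eb2 : lin_coef2 se (fun i => c * rho i) u v j = c * lin_coef2 se rho u v j.
  by rewrite /lin_coef2 mulr_sumr; apply: eq_bigr => i _; ring.
have Er : cst_coef2 sx se (c * k) (fun i => c * rho i) u v j =
    c * cst_coef2 sx se k rho u v j.
  rewrite /cst_coef2 mulrDr mulr_sumr; congr +%R; first by ring.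
  by apply: eq_bigr => i _; ring.
by rewrite /obs_info_level Ea !E1 E2 Eb !Eb1 Eb2 Er; field; rewrite a0.
Qed.

(** The derivative of alpha_i + beta_i x in the direction [v]. *)
Definition tangent (x : R) v (i : 'I_q.+1) : R := alpha v i + x * slope v i.

Definition limit_info rho theta (x : m.-tuple R) u v : R :=
  obs_info sx se 0 0 rho
    (fun i j => rho i * (alpha theta i + beta theta i * tnth x j)) theta u v.

Lemma beta0 theta : beta theta ord0 = 1.
Proof. by rewrite /beta unlift_none. Qed.

Lemma quad_coef_limit_gt0 rho theta j :
  (forall i, 0 < rho i) -> 0 < quad_coef sx se 0 rho theta j.
Proof.
move=> r0; rewrite /quad_coef mul0r add0r (bigD1 ord0)//= beta0 expr1n mulr1.
apply: ltr_pwDl; first by rewrite mulr_gt0// invr_gt0 exprn_gt0.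
apply: sumr_ge0 => i _; apply: mulr_ge0; last exact: sqr_ge0.
by apply: mulr_ge0; [exact: ltW|rewrite invr_ge0 sqr_ge0].
Qed.

(** At the limit statistics b = x a, so the fitted level b / a is x itself and
    the derivative of b is x times that of a minus a weighted sum of tangents.
    What remains is the Gram form of the tangents in the weights
    rho_i / se_ij^2, from which the part along beta is projected out: the
    information left about the laboratories when the levels are unknown. *)
Lemma limit_infoE rho theta x u v : (forall i, 0 < rho i) ->
  limit_info rho theta x u v =
  \sum_j ((\sum_i rho i * (se i j ^+ 2)^-1 *
             tangent (tnth x j) u i * tangent (tnth x j) v i)
    - (\sum_i rho i * (se i j ^+ 2)^-1 * beta theta i * tangent (tnth x j) u i)
    * (\sum_i rho i * (se i j ^+ 2)^-1 * beta theta i * tangent (tnth x j) v i)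
    / quad_coef sx se 0 rho theta j).
Proof.
move=> r0; apply: eq_bigr => j _.
have a0 := lt0r_neq0 (quad_coef_limit_gt0 theta j r0).
set z := tnth x j.
set T := fun i j => rho i * (alpha theta i + beta theta i * tnth x j).
have Eb : lin_coef sx se 0 rho T theta j = z * quad_coef sx se 0 rho theta j.
  rewrite /lin_coef /quad_coef !mul0r !add0r mulr_sumr; apply: eq_bigr => i _.
  by rewrite /T -/z; ring.
have Eb1 w : lin_coef1 sx se 0 rho T theta w j = z * quad_coef1 se rho theta w j -
    \sum_i rho i * (se i j ^+ 2)^-1 * beta theta i * tangent z w i.
  rewrite /lin_coef1 /quad_coef1 !mul0r !add0r mulr_sumr -sumrB.
  apply: eq_bigr => i _.
  by rewrite /T -/z /tangent; ring.
have Er : \sum_i rho i * (se i j ^+ 2)^-1 * tangent z u i * tangent z v i =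
    cst_coef2 sx se 0 rho u v j / 2 - z * lin_coef2 se rho u v j
    + z ^+ 2 * quad_coef2 se rho u v j / 2.
  rewrite /cst_coef2 mulr0 !mul0r !add0r /lin_coef2 /quad_coef2.
  rewrite !mulr_sumr !mulr_suml.
  rewrite -sumrB -big_split; apply: eq_bigr => i _ /=.
  by rewrite /tangent; field; exact: lt0r_neq0.
by rewrite /obs_info_level Eb !Eb1 Er; field.
Qed.

Lemma weighted_cauchy_schwarz (I : finType) (c b z : I -> R) :
  (forall i, 0 <= c i) -> 0 < \sum_i c i * b i ^+ 2 ->
  (\sum_i c i * b i * z i) ^+ 2 / \sum_i c i * b i ^+ 2 <=
  \sum_i c i * z i ^+ 2.
Proof.
move=> c0 a0; set a := \sum_i _ * b _ ^+ 2; set g := \sum_i c i * b i * z i.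
(* The residual of the weighted projection of [z] on [b] has norm >= 0. *)
have : 0 <= \sum_i c i * (z i - g / a * b i) ^+ 2.
  by apply: sumr_ge0 => i _; rewrite mulr_ge0 ?sqr_ge0.
have E t : \sum_i c i * (z i - t * b i) ^+ 2 =
    \sum_i c i * z i ^+ 2 - 2 * t * g + t ^+ 2 * a.
  rewrite /g /a !mulr_sumr -sumrB -big_split.
  by apply: eq_bigr => i _ /=; ring.
rewrite E.
rewrite (_ : _ + _ = \sum_i c i * z i ^+ 2 - g ^+ 2 / a) ?subr_ge0//.
by field; exact: lt0r_neq0.
Qed.

Definition limit_info_mx rho theta (x : m.-tuple R) : 'M[R]_(pdim q m) :=
  \matrix_(h, s) limit_info rho theta x (delta_mx ord0 h) (delta_mx ord0 s).

Lemma tangent_linear (x : R) v i :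
  \sum_h v ord0 h * tangent x (delta_mx ord0 h) i = tangent x v i.
Proof.
have E (w : 'rV[R]_(pdim q m)) a :
    \sum_h w ord0 h * delta_mx ord0 h ord0 a = w ord0 a.
  rewrite (bigD1 a)//= big1 ?addr0 => [|b ba]; first by rewrite mxE !eqxx mulr1.
  by rewrite mxE eqxx eq_sym (negbTE ba) mulr0.
rewrite /tangent /alpha /slope; case: unliftP => [l _|_].
  under eq_bigr do rewrite mulrDr mulrCA.
  by rewrite big_split/= -mulr_sumr !E.
by rewrite mulr0 addr0; apply: big1 => h _; rewrite mulr0.
Qed.

Lemma limit_infoC rho theta x u v : (forall i, 0 < rho i) ->
  limit_info rho theta x u v = limit_info rho theta x v u.
Proof.
move=> r0; rewrite !limit_infoE//; apply: eq_bigr => j _.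
congr (_ - _); first by apply: eq_bigr => i _; rewrite mulrAC.
by congr (_ / _); rewrite mulrC.
Qed.

Lemma limit_info_linear rho theta x u v : (forall i, 0 < rho i) ->
  \sum_s v ord0 s * limit_info rho theta x u (delta_mx ord0 s) =
  limit_info rho theta x u v.
Proof.
move=> r0; rewrite limit_infoE//.
have lin (c : 'I_q.+1 -> R) y : \sum_s v ord0 s *
    (\sum_i c i * tangent y (delta_mx ord0 s) i) = \sum_i c i * tangent y v i.
  under eq_bigr do rewrite mulr_sumr.
  rewrite exchange_big; apply: eq_bigr => i _ /=.
  by rewrite -tangent_linear mulr_sumr; apply: eq_bigr => s _; rewrite mulrCA.
under eq_bigr do rewrite limit_infoE// mulr_sumr.
rewrite exchange_big; apply: eq_bigr => j _ /=.
rewrite -[in RHS]lin -[X in _ - _ * X / _]lin.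
rewrite mulr_sumr mulr_suml -sumrB; apply: eq_bigr => s _.
by rewrite mulrBr; congr (_ - _); rewrite !mulrA; congr (_ / _); ring.
Qed.

Lemma psd_limit_info_mx rho theta x :
  (forall i, 0 < rho i) -> psd (limit_info_mx rho theta x).
Proof.
move=> r0; split.
  by apply/matrixP => h s; rewrite !mxE limit_infoC.
move=> v; have -> : (v *m limit_info_mx rho theta x *m v^T) ord0 ord0 =
    limit_info rho theta x v v.
  rewrite mxE -limit_info_linear//; apply: eq_bigr => s _.
  rewrite mxE [v^T _ _]mxE mulrC; congr (_ * _).
  rewrite limit_infoC// -limit_info_linear//; apply: eq_bigr => h _.
  by rewrite mxE limit_infoC.
rewrite limit_infoE//; apply: sumr_ge0 => j _; rewrite subr_ge0.
pose c i := rho i * (se i j ^+ 2)^-1.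
have Ea : quad_coef sx se 0 rho theta j = \sum_i c i * beta theta i ^+ 2.
  by rewrite /quad_coef mul0r add0r.
have c0 i : 0 <= c i.
  by apply: mulr_ge0; [exact: ltW|rewrite invr_ge0 sqr_ge0].
have a0 := quad_coef_limit_gt0 theta j r0.
rewrite Ea in a0 *.
have := weighted_cauchy_schwarz (tangent (tnth x j) v) c0 a0.
rewrite expr2 => /le_trans; apply.
rewrite le_eqVlt; apply/orP; left; apply/eqP/eq_bigr => i _.
by rewrite expr2 mulrA.
Qed.

End LimitingInformation.

(** * The marginal density of the observations *)

Section MarginalDensity.
Context {R : realType}.

(** Completing the square: the mean is b / a and the variance 1 / a. *)
Lemma normal_pdf_quadratic (a b d u : R) : 0 < a ->
  expR (- (a * u ^+ 2 - 2 * b * u + d) / 2) =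
  expR (b ^+ 2 / (2 * a) - d / 2) / normal_peak (Num.sqrt a)^-1 *
  normal_pdf (b / a) (Num.sqrt a)^-1 u.
Proof.
move=> a0; have sa : 0 < Num.sqrt a by rewrite sqrtr_gt0.
have s0 : (Num.sqrt a)^-1 != 0 by rewrite invr_neq0// lt0r_neq0.
rewrite normal_pdfE//= [RHS]mulrA divfK; last first.
  by rewrite lt0r_neq0// normal_peak_gt0.
rewrite /normal_fun -expRD exprVn sqr_sqrtr ?(ltW a0)//.
by congr expR; field; exact: lt0r_neq0.
Qed.

Lemma integrable_gaussian (a b d : R) : 0 < a ->
  (@lebesgue_measure R).-integrable setT
    (EFin \o (fun u => expR (- (a * u ^+ 2 - 2 * b * u + d) / 2))).
Proof.
move=> a0; rewrite (_ : EFin \o _ = fun u =>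
    ((expR (b ^+ 2 / (2 * a) - d / 2) / normal_peak (Num.sqrt a)^-1)%:E *
    (normal_pdf (b / a) (Num.sqrt a)^-1 u)%:E)%E).
  by apply: integrableZl => //; exact: integrable_normal_pdf.
by apply/funext => u /=; rewrite normal_pdf_quadratic.
Qed.

Lemma Rintegral_gaussian (a b d : R) : 0 < a ->
  Rintegral (@lebesgue_measure R) setT
    (fun u => expR (- (a * u ^+ 2 - 2 * b * u + d) / 2)) =
  expR (b ^+ 2 / (2 * a) - d / 2) * Num.sqrt (2 * pi / a).
Proof.
move=> a0; under eq_Rintegral do rewrite normal_pdf_quadratic//.
rewrite RintegralZl//; last exact: integrable_normal_pdf.
rewrite {1}/Rintegral integral_normal_pdf /= mulr1; congr (_ * _).
rewrite /normal_peak invrK exprVn sqr_sqrtr ?(ltW a0)//.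
by congr Num.sqrt; rewrite -mulr_natl; ring.
Qed.

(** The factor [c] carries, in the induction on the number of variables, the
    factors of the variables that are already fixed. *)
Lemma iterated_integral_prod (m : nat) (f : 'I_m -> R -> R) (c : R) :
  (forall j, (@lebesgue_measure R).-integrable setT (EFin \o f j)) ->
  iterated_integral (fun x => c * \prod_(j < m) f j (tnth x j)) =
  c * \prod_(j < m) Rintegral (@lebesgue_measure R) setT (f j).
Proof.
elim: m f c => [|m IH] f c fi /=; first by rewrite !big_ord0.
pose K := c *
  \prod_(j < m) Rintegral (@lebesgue_measure R) setT (f (lift ord0 j)).
transitivity (Rintegral (@lebesgue_measure R) setT (fun u => K * f ord0 u));
  last first.
  by rewrite RintegralZl ?big_ord_recl// /K mulrCA mulrC mulrA.
apply: eq_Rintegral => u _; rewrite /K mulrAC.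
rewrite -(IH (fun j => f (lift ord0 j)))//.
congr iterated_integral; apply/funext => v.
rewrite big_ord_recl tnth0 mulrA; congr (_ * _).
by apply: eq_bigr => j _; rewrite tnthS.
Qed.
End MarginalDensity.

Section Loglikelihood.
Context {R : realType} {q m : nat}.
Variables (sx : 'I_m -> R) (se : 'I_q.+1 -> 'I_m -> R) (ns : 'I_q.+1 -> nat).
Hypotheses (hsx : forall j, 0 < sx j) (hse : forall i j, 0 < se i j).

Definition cell (i : 'I_q.+1) (j : 'I_m) (k : 'I_(ns i)) : obs m ns :=
  existT _ i (j, k).

Definition cell_sum (z : obs m ns -> R) i j : R := \sum_(k < ns i) z (cell j k).

Definition observation (y : #|{: obs m ns}|.-tuple R) (o : obs m ns) : R :=
  tnth y (enum_rank o).

Lemma big_cell (T : Type) (idx : T) (op : Monoid.com_law idx)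
    (F : obs m ns -> T) :
  \big[op/idx]_o F o =
  \big[op/idx]_j \big[op/idx]_i \big[op/idx]_(k < ns i) F (cell j k).
Proof.
have E := sig_big_dep (op := op)
  (J := fun i => ('I_m * 'I_(ns i))%type : finType) xpredT (fun _ => xpredT)
  (fun i (jk : 'I_m * 'I_(ns i)) => F (existT _ i jk)).
rewrite exchange_big /= (eq_bigr (fun o => F (existT _ (tag o) (tagged o))));
  last by case.
rewrite -[LHS]E; apply: eq_bigr => i _.
by rewrite pair_bigA /=; apply: eq_bigr => -[].
Qed.

Lemma joint_densityE theta (y : #|{: obs m ns}|.-tuple R) (x : m.-tuple R) :
  joint_density sx se theta x y =
  \prod_j (normal_pdf (mu theta j) (sx j) (tnth x j) *
    \prod_i \prod_(k < ns i)
      normal_pdf (alpha theta i + beta theta i * tnth x j) (se i j)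
        (observation y (cell j k))).
Proof.
rewrite big_split/=; congr (_ * _).
rewrite (reindex enum_rank (onW_bij _ (@enum_rank_bij _)))/= big_cell.
by do 3 (apply: eq_bigr => ? _); rewrite enum_rankK.
Qed.

Let level_exponent theta (y : #|{: obs m ns}|.-tuple R) j (u : R) :=
  quad_coef sx se 1 (fun i => (ns i)%:R) theta j * u ^+ 2
  - 2 * lin_coef sx se 1 (fun i => (ns i)%:R) (cell_sum (observation y)) theta j
      * u
  + (cst_coef sx se 1 (fun i => (ns i)%:R) (cell_sum (observation y)) theta j +
     \sum_i (se i j ^+ 2)^-1 * \sum_(k < ns i) observation y (cell j k) ^+ 2).

(** As a function of u = x_j the exponent is quadratic, and its coefficients
    depend on the observations only through the cell sums, apart from the squares,
    which do not involve the parameter. *)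
Lemma level_densityE theta (y : #|{: obs m ns}|.-tuple R) j (u : R) :
  normal_pdf (mu theta j) (sx j) u *
    \prod_i \prod_(k < ns i)
      normal_pdf (alpha theta i + beta theta i * u) (se i j)
        (observation y (cell j k)) =
  normal_peak (sx j) * (\prod_i \prod_(k < ns i) normal_peak (se i j)) *
  expR (- level_exponent theta y j u / 2).
Proof.
have hx := lt0r_neq0 (hsx j).
under eq_bigr => i _.
  under eq_bigr => k _ do rewrite normal_pdfE ?lt0r_neq0//=.
  rewrite big_split/= /normal_fun -expR_sum; over.
rewrite big_split/= -expR_sum normal_pdfE//=.
rewrite /normal_fun mulrACA -expRD; congr (_ * expR _).
rewrite /level_exponent /quad_coef /lin_coef /cst_coef.
set P := \sum_i _ * _ ^+ 2; set Q := \sum_i _ * (_ - _).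
set N := \sum_i _ * (_ - 2 * _ * _); set Z := \sum_i _ * \sum_(k < _) _.
suff -> : \sum_i \sum_(k < ns i) - (observation y (cell j k) -
    (alpha theta i + beta theta i * u)) ^+ 2 / (se i j ^+ 2 *+ 2) =
    - (P * u ^+ 2 - 2 * Q * u + (N + Z)) / 2.
  by field.
rewrite /P /Q /N /Z mulr_suml !(mulr_suml, mulr_sumr) -sumrB -!big_split/=.
rewrite -sumrN mulr_suml; apply: eq_bigr => i _.
have hs := lt0r_neq0 (hse i j).
set c := alpha theta i + beta theta i * u.
have -> : \sum_(k < ns i)
      - (observation y (cell j k) - c) ^+ 2 / (se i j ^+ 2 *+ 2) =
    - (\sum_(k < ns i) observation y (cell j k) ^+ 2
        - 2 * c * cell_sum (observation y) i j + (ns i)%:R * c ^+ 2)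
     / (2 * se i j ^+ 2).
  have -> : (ns i)%:R * c ^+ 2 = \sum_(k < ns i) c ^+ 2.
    by rewrite sumr_const card_ord mulr_natl.
  rewrite /cell_sum mulr_sumr -sumrB -big_split -sumrN mulr_suml.
  by apply: eq_bigr => k _ /=; field.
by rewrite /c; field.
Qed.

Lemma sqrtr_expR_ln (x : R) : 0 < x -> Num.sqrt x = expR (ln x / 2).
Proof.
move=> x0; rewrite -{1}(lnK x0) (_ : expR (ln x) = expR (ln x / 2) ^+ 2).
  by rewrite sqrtr_sqr ger0_norm// expR_ge0.
by rewrite expr2 -expRD; congr expR; field.
Qed.

Theorem loglikE (y : #|{: obs m ns}|.-tuple R) : exists C, forall theta,
  loglik sx se y theta =
  C + profile sx se 1 (fun i => (ns i)%:R) (cell_sum (observation y)) theta.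
Proof.
pose c j := normal_peak (sx j) *
  (\prod_i \prod_(k < ns i) normal_peak (se i j)).
pose sq j := \sum_i (se i j ^+ 2)^-1 *
  \sum_(k < ns i) observation y (cell j k) ^+ 2.
have c0 j : 0 < c j.
  rewrite mulr_gt0 ?normal_peak_gt0 ?lt0r_neq0//.
  apply: prodr_gt0 => i _; apply: prodr_gt0 => k _.
  by rewrite normal_peak_gt0 ?lt0r_neq0.
exists (\sum_j (ln (c j) - sq j / 2 + ln (2 * pi) / 2)) => theta.
pose a j := quad_coef sx se 1 (fun i => (ns i)%:R) theta j.
have a0 j : 0 < a j by exact: quad_coef_gt0.
pose b j := lin_coef sx se 1 (fun i => (ns i)%:R)
  (cell_sum (observation y)) theta j.
pose d j := cst_coef sx se 1 (fun i => (ns i)%:R)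
  (cell_sum (observation y)) theta j + sq j.
pose f j u := c j * expR (- (a j * u ^+ 2 - 2 * b j * u + d j) / 2).
have -> : loglik sx se y theta = ln (iterated_integral
    (fun x : m.-tuple R => 1 * \prod_j f j (tnth x j))).
  congr (ln (iterated_integral _)); apply/funext => x.
  rewrite joint_densityE mul1r; apply: eq_bigr => j _.
  exact: level_densityE.
have fi j : (@lebesgue_measure R).-integrable setT (EFin \o f j).
  rewrite (_ : EFin \o f j = fun u => ((c j)%:E *
     (expR (- (a j * u ^+ 2 - 2 * b j * u + d j) / 2))%:E)%E)//.
  by apply: integrableZl => //; exact: integrable_gaussian.
rewrite iterated_integral_prod// mul1r.
have -> : \prod_j Rintegral (@lebesgue_measure R) setT (f j) =
   expR (\sum_j (ln (c j) - sq j / 2 + ln (2 * pi) / 2) +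
     profile sx se 1 (fun i => (ns i)%:R) (cell_sum (observation y)) theta).
  rewrite -big_split expR_sum; apply: eq_bigr => j _ /=.
  rewrite /f RintegralZl//; last exact: integrable_gaussian.
  rewrite Rintegral_gaussian// -{1}(lnK (c0 j)).
  have p0 : 0 < 2 * pi :> R by rewrite mulr_gt0// pi_gt0.
  rewrite sqrtr_expR_ln ?divr_gt0// ln_div ?posrE// -2!expRD; congr expR.
  by rewrite /d -/(a j) -/(b j); field; exact: lt0r_neq0.
by rewrite expRK.
Qed.

Theorem J_obs_infoE (y : #|{: obs m ns}|.-tuple R) theta h s :
  J sx se y theta h s = obs_info sx se 1 1 (fun i => (ns i)%:R)
    (cell_sum (observation y)) theta (delta_mx ord0 h) (delta_mx ord0 s).
Proof.
have [C lE] := loglikE y; rewrite mxE /partial_deriv.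
rewrite (_ : loglik sx se y = fun t => C + profile sx se 1 (fun i => (ns i)%:R)
  (cell_sum (observation y)) t); last exact/funext.
rewrite (_ : (fun t => _) = fun t => profile1 sx se 1 (fun i => (ns i)%:R)
   (cell_sum (observation y)) t (delta_mx ord0 s)); last first.
  by apply/funext => t; rewrite derive_profile.
by rewrite derive_profile1// opprK.
Qed.

End Loglikelihood.

(** * Integration against a density *)

Section IntegralAgainstDensity.
Context d (T : measurableType d) (R : realType).
Variables (mu nu : {measure set T -> \bar R}) (f : T -> R).
Hypotheses (mf : measurable_fun setT f) (f0 : forall x, 0 <= f x)
  (nuE : forall A, measurable A -> nu A = (\int[mu]_(x in A) (f x)%:E)%E).

Import HBNNSimple.

Let integral_density_indic E : measurable E ->
  (\int[nu]_x (\1_E x)%:E = \int[mu]_x ((\1_E x)%:E * (f x)%:E))%E.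
Proof.
move=> mE; rewrite integral_indic//= setIT nuE// integral_mkcond.
apply: eq_integral => x _; rewrite patchE indicE.
by case: (x \in E); rewrite ?mul1e ?mul0e.
Qed.

Let integral_density_nnsfun (h : {nnsfun T >-> R}) :
  (\int[nu]_x (h x)%:E = \int[mu]_x ((h x)%:E * (f x)%:E))%E.
Proof.
under [LHS]eq_integral do rewrite fimfunE -fsumEFin//.
rewrite [LHS]ge0_integral_fsum//; last 2 first.
  - by move=> r; exact/measurable_EFinP/measurableT_comp.
  - by move=> n x _; rewrite EFinM nnfun_muleindic_ge0.
under [RHS]eq_integral.
  move=> x xD; rewrite fimfunE -fsumEFin// muleC ge0_mule_fsumr; last first.
    by move=> r; rewrite EFinM nnfun_muleindic_ge0.
  over.
rewrite [RHS]ge0_integral_fsum//; last 2 first.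
  - move=> r; apply/measurable_EFinP; apply: measurable_funM => //.
    exact: measurableT_comp.
  - move=> n x _; rewrite EFinM mule_ge0//; last by rewrite nnfun_muleindic_ge0.
    by rewrite lee_fin.
apply: eq_fsbigr => r _.
rewrite integralZl_indic_nnsfun// integral_density_indic//.
have [r0|r0] := leP 0 r.
  rewrite -ge0_integralZl//.
  - by apply: eq_integral => x _; rewrite EFinM muleA muleC.
  - by apply: emeasurable_funM; apply/measurable_EFinP.
  - by move=> x _; rewrite mule_ge0// lee_fin.
have -> : h @^-1` [set r] = set0.
  by apply/seteqP; split => // x /= hx; move: r0; rewrite -hx ltNge fun_ge0.
under eq_integral do rewrite indic0 mul0e.
rewrite integral0 mule0; under eq_integral do rewrite indic0 mulr0 mule0.
by rewrite integral0.
Qed.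

(** The identity holds for indicators by the definition of [nu], for simple
    functions by additivity, and in general by monotone convergence. *)
Lemma ge0_integral_density (g : T -> \bar R) :
  measurable_fun setT g -> (forall x, 0 <= g x)%E ->
  (\int[nu]_x g x = \int[mu]_x (g x * (f x)%:E))%E.
Proof.
move=> mg g0.
pose g_ := nnsfun_approx measurableT mg.
have nd x : {homo (fun n => (g_ n x)%:E) : a b / (a <= b)%N >-> (a <= b)%E}.
  by move=> a b ab; rewrite lee_fin; exact/lefP/nd_nnsfun_approx.
transitivity (limn (fun n => \int[nu]_x (g_ n x)%:E)%E).
  rewrite -monotone_convergence//=.
  - apply: eq_integral => ? _; apply/esym/cvg_lim => //=.
    exact: cvg_nnsfun_approx.
  - by move=> n; exact/measurable_EFinP/measurable_funTS.
  - by move=> n ? _; rewrite lee_fin.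
transitivity (limn (fun n => \int[mu]_x ((g_ n x)%:E * (f x)%:E))%E).
  by apply: congr_lim; apply/funext => n /=; exact: integral_density_nnsfun.
rewrite -monotone_convergence//=.
- apply: eq_integral => x _; apply/cvg_lim => //.
  by apply: cvgeZr => //; exact: cvg_nnsfun_approx.
- by move=> n; apply: emeasurable_funM; exact/measurable_EFinP.
- by move=> n x _; rewrite mule_ge0// lee_fin.
- by move=> x _ a b ab; rewrite lee_wpmul2r ?lee_fin//; apply: nd.
Qed.

End IntegralAgainstDensity.

(** * Moments of normal variables *)

Section NormalMoments.
Context {R : realType} d (T : measurableType d) (P : probability T R).
Local Open Scope ereal_scope.

Lemma ge0_integral_normal (X : {RV P >-> R}) (a s : R) (g : R -> R) :
  has_normal_law X a s -> measurable_fun setT g -> (forall x, 0 <= g x)%R ->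
  \int[P]_t (g (X t))%:E =
  \int[@lebesgue_measure R]_x (g x * normal_pdf a s x)%:E.
Proof.
move=> lawX mg g0.
(* The Lebesgue measure lives on [measurableTypeR R], whose measurable sets are
   those of [R] but whose display differs: [X] is read with that codomain. *)
have mX : measurable_fun [set: T] (X : T -> measurableTypeR R).
  by move=> _ A mA; exact: (@measurable_funPT _ _ _ _ X).
pose X' : {mfun T >-> measurableTypeR R} :=
  MeasurableFun.Pack (MeasurableFun.Class (isMeasurableFun.Build _ _ _ _ _ mX)).
have mEg : measurable_fun [set: measurableTypeR R] (EFin \o g).
  by apply/measurable_EFinP => _ A mA; exact: mg.
have Eg0 x : 0 <= (EFin \o g) x by rewrite lee_fin.
have mpdf : measurable_fun [set: measurableTypeR R] (normal_pdf a s).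
  by move=> _ A mA; exact: measurable_normal_pdf.
have := @ge0_integral_density _ _ R lebesgue_measure (distribution P X') _ mpdf
  (normal_pdf_ge0 a s) lawX _ mEg Eg0.
by rewrite ge0_integral_distribution// => ->.
Qed.

(** An upper bound for the variance, obtained by comparison with the normal law
    of twice the variance; only its finiteness and its independence of the
    mean matter. *)
Definition normal_moment2_bound (s : R) : R :=
  (4 * s ^+ 2 * normal_peak s / normal_peak (Num.sqrt 2 * s))%R.

(** With y = (x - a)^2 / (4 s^2) the Gaussian factor is exp (- 2 y), and
    y exp (- 2 y) <= exp (- y) because y <= exp y. *)
Lemma sqr_normal_pdf_le (a s x : R) : (0 < s)%R ->
  ((x - a) ^+ 2 * normal_pdf a s x <=
   normal_moment2_bound s * normal_pdf a (Num.sqrt 2 * s) x)%R.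
Proof.
move=> s0.
have s20 : (0 < Num.sqrt 2 * s :> R)%R by rewrite mulr_gt0// sqrtr_gt0.
rewrite !normal_pdfE ?lt0r_neq0//= /normal_moment2_bound.
set p := normal_peak s; set p' := normal_peak _.
have p0 : (0 < p)%R by rewrite normal_peak_gt0// lt0r_neq0.
have p'0 : (0 < p')%R by rewrite normal_peak_gt0// lt0r_neq0.
rewrite [leRHS]mulrA divfK ?lt0r_neq0// mulrCA (mulrC _ p) -[leRHS]mulrA.
rewrite ler_pM2l// /normal_fun exprMn sqr_sqrtr//.
set y := ((x - a) ^+ 2 / (4 * s ^+ 2))%R.
have -> : (- (x - a) ^+ 2 / (s ^+ 2 *+ 2) = - y - y)%R.
  by rewrite /y; field; exact: lt0r_neq0.
have -> : (- (x - a) ^+ 2 / (2 * s ^+ 2 *+ 2) = - y)%R.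
  by rewrite /y; field; exact: lt0r_neq0.
have -> : ((x - a) ^+ 2 = (4 * s ^+ 2) * y)%R.
  by rewrite /y; field; exact: lt0r_neq0.
rewrite -[leLHS]mulrA ler_pM2l ?mulr_gt0 ?exprn_gt0//.
rewrite expRD mulrA ler_piMl ?expR_ge0// expRN ler_pdivrMr ?expR_gt0// mul1r.
by apply: le_trans (expR_ge1Dx y); rewrite lerDr.
Qed.

Lemma normal_second_moment (X : {RV P >-> R}) (a s : R) : (0 < s)%R ->
  has_normal_law X a s ->
  \int[P]_t ((X t - a) ^+ 2)%:E <= (normal_moment2_bound s)%:E.
Proof.
move=> s0 lawX.
have mg : measurable_fun setT (fun x : R => (x - a) ^+ 2)%R.
  by apply: measurable_funX; exact: measurable_funB.
rewrite (ge0_integral_normal lawX mg) => [|x]; last exact: sqr_ge0.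
have b0 : (0 <= normal_moment2_bound s)%R.
  rewrite divr_ge0 ?normal_peak_ge0// mulr_ge0 ?normal_peak_ge0//.
  by rewrite mulr_ge0// sqr_ge0.
rewrite -[leRHS]mule1 -(integral_normal_pdf a (Num.sqrt 2 * s)).
rewrite -ge0_integralZl//; last 2 first.
- by apply/measurable_EFinP; exact: measurable_normal_pdf.
- by move=> x _; rewrite lee_fin normal_pdf_ge0.
apply: ge0_le_integral => //.
- by move=> x _; rewrite lee_fin mulr_ge0 ?sqr_ge0 ?normal_pdf_ge0.
- apply/measurable_EFinP; apply: measurable_funM => //.
  exact: measurable_normal_pdf.
- apply/measurable_EFinP; apply: measurable_funM => //.
  exact: measurable_normal_pdf.
- by move=> x _; rewrite -EFinM lee_fin sqr_normal_pdf_le.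
Qed.

Lemma normal_integrable (X : {RV P >-> R}) (s : R) : (0 < s)%R ->
  has_normal_law X 0 s -> P.-integrable setT (fun t => (X t)%:E).
Proof.
move=> s0 lawX; apply: (@le_integrable _ _ _ P _ measurableT _
   (fun t => (1 + (X t - 0) ^+ 2)%:E)).
- exact/measurable_EFinP.
- move=> t _; rewrite !abse_EFin lee_fin subr0.
  rewrite (ger0_norm (addr_ge0 _ (sqr_ge0 _)))//.
  rewrite -(real_normK (num_real (X t))).
  by have := normr_ge0 (X t); nra.
- under [X in _.-integrable _ X]eq_fun do rewrite EFinD.
  apply: integrableD => //; first exact: finite_measure_integrable_cst.
  apply/integrableP; split.
    by apply/measurable_EFinP; apply: measurable_funX; exact: measurable_funB.
  under eq_integral do rewrite gee0_abs ?lee_fin ?sqr_ge0//.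
  exact: le_lt_trans (normal_second_moment s0 lawX) (ltry _).
Qed.

End NormalMoments.

Section CenteredNormal.
Context {R : realType}.
Local Open Scope ereal_scope.

Lemma ge0_integral_opp (f : R -> \bar R) :
  measurable_fun [set: measurableTypeR R] f -> (forall x, 0 <= f x) ->
  \int[@lebesgue_measure R]_x f (- x)%R = \int[@lebesgue_measure R]_x f x.
Proof.
move=> mf f0.
have mN : measurable_fun [set: measurableTypeR R]
    (-%R : measurableTypeR R -> measurableTypeR R).
  by move=> _ A mA; exact: (@oppr_measurable R setT).
have := @ge0_integral_pushforward _ _ _ _ R _ mN lebesgue_measure setT f
  measurableT.
rewrite preimage_setT => <-//.
by apply: eq_measure_integral => A mA _; exact: lebesgue_measureN.
Qed.

Context d (T : measurableType d) (P : probability T R).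

(** The density is even, so the positive and the negative part have the same
    integral. *)
Lemma normal_mean0 (X : {RV P >-> R}) (s : R) : (0 < s)%R ->
  has_normal_law X 0 s -> \int[P]_t (X t)%:E = 0.
Proof.
move=> s0 lawX.
have mp : measurable_fun setT (fun x : R => Num.max x 0)%R.
  exact: measurable_maxr.
have mn : measurable_fun setT (fun x : R => Num.max (- x) 0)%R.
  by apply: measurable_maxr.
have max0 (y : R) : (0 <= Num.max y 0)%R by rewrite le_max lexx orbT.
have Ep := ge0_integral_normal lawX mp (fun x => max0 x).
have En := ge0_integral_normal lawX mn (fun x => max0 (- x)%R).
have Epn : \int[P]_t (Num.max (- X t) 0)%:E = \int[P]_t (Num.max (X t) 0)%:E.
  rewrite Ep En -[RHS]ge0_integral_opp.
  - apply: eq_integral => x _; congr (_ * _)%:E.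
    by rewrite !normal_pdfE ?lt0r_neq0//= /normal_fun !subr0 sqrrN.
  - apply/measurable_EFinP; apply: measurable_funM.
      by move=> _ A mA; exact: mp.
    exact: measurable_normal_pdf.
  - by move=> x; rewrite lee_fin mulr_ge0 ?normal_pdf_ge0// le_max lexx orbT.
have iX := normal_integrable s0 lawX.
rewrite integralE.
rewrite (eq_integral (fun t => (Num.max (X t) 0)%:E)); last first.
  by move=> t _; rewrite funeposE EFin_max.
rewrite [X in _ - X](eq_integral (fun t => (Num.max (- X t) 0)%:E)); last first.
  by move=> t _; rewrite funenegE EFin_max.
rewrite Epn subee// -Epn.
have := integrable_funeneg measurableT iX => /integrable_fin_num.
rewrite (eq_integral (fun t => (Num.max (- X t) 0)%:E)); last first.
  by move=> t _; rewrite funenegE EFin_max.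
exact.
Qed.

End CenteredNormal.

(** * Uncorrelated variables and Chebyshev's inequality *)

Section SecondMoments.
Context {R : realType} d (T : measurableType d) (P : probability T R).
Local Open Scope ereal_scope.

(** Under the product rule the law of (X, Y) agrees with the product of the two
    laws on rectangles, hence everywhere, and Fubini's theorem applies. *)
Lemma integral_independent_product (X Y : {RV P >-> R}) :
  (forall A B : set R, measurable A -> measurable B ->
     P (X @^-1` A `&` Y @^-1` B) = P (X @^-1` A) * P (Y @^-1` B)) ->
  P.-integrable setT (fun t => (X t)%:E) ->
  P.-integrable setT (fun t => (Y t)%:E) ->
  P.-integrable setT (fun t => (X t * Y t)%:E) ->
  \int[P]_t (X t * Y t)%:E = \int[P]_t (X t)%:E * \int[P]_t (Y t)%:E.
Proof.
move=> indep iX iY iXY.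
have mXY : measurable_fun setT (fun t => (X t, Y t)).
  exact: measurable_fun_pair.
pose XY : {mfun T >-> (R * R)%type} := MeasurableFun.Pack
  (MeasurableFun.Class (isMeasurableFun.Build _ _ _ _ _ mXY)).
have mM : measurable_fun [set: R * R] (fun z : R * R => (z.1 * z.2)%:E).
  by apply/measurable_EFinP; apply: measurable_funM.
have prodE (C : set (R * R)) : measurable C ->
    (distribution P X \x distribution P Y) C = distribution P XY C.
  by move=> mC; apply: product_measure_unique.
have iD : (distribution P XY).-integrable setT
    (fun z : R * R => (z.1 * z.2)%:E).
  exact: integrable_pushforward.
have iM : (distribution P X \x distribution P Y).-integrable setT
    (fun z : R * R => (z.1 * z.2)%:E).
  apply/integrableP; split => //.
  rewrite (eq_measure_integral (distribution P XY)) => [|A mA _];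
    last exact: prodE.
  by have /integrableP[] := iD.
have iX' : (distribution P X).-integrable setT (fun x : R => x%:E).
  by apply: integrable_pushforward => //; exact/measurable_EFinP.
have iY' : (distribution P Y).-integrable setT (fun x : R => x%:E).
  by apply: integrable_pushforward => //; exact/measurable_EFinP.
transitivity (\int[distribution P XY]_z (z.1 * z.2)%:E).
  by rewrite integral_distribution.
rewrite (eq_measure_integral (distribution P X \x distribution P Y));
  last first.
  by move=> A mA _; exact/esym/prodE.
rewrite -integral12_prod_meas1//=.
have -> : \int[P]_t (X t)%:E = \int[distribution P X]_x x%:E.
  by rewrite integral_distribution//; exact/measurable_EFinP.
have EY : \int[P]_t (Y t)%:E = \int[distribution P Y]_x x%:E.
  by rewrite integral_distribution//; exact/measurable_EFinP.
have fY : \int[P]_t (Y t)%:E \is a fin_num by exact: integrable_fin_num.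
rewrite -[in RHS](fineK fY) -integralZr//; apply: eq_integral => x _.
rewrite fineK// EY /fubini_F/=.
by under eq_integral do rewrite EFinM; rewrite integralZl.
Qed.

Lemma markov_sqr (X : T -> R) (eps : R) : measurable_fun setT X ->
  (0 < eps)%R ->
  P [set t | eps <= `|X t| ]%R <= (eps ^- 2)%:E * \int[P]_t (X t ^+ 2)%:E.
Proof.
move=> mX e0; set A := [set t | _].
have mA : measurable A.
  rewrite -[A]setTI; apply: measurable_fun_le => //.
  exact: measurableT_comp.
have e2 : (0 < eps ^+ 2)%R by rewrite exprn_gt0.
rewrite -lee_pdivrMl ?invr_gt0// invrK -integral_cst//.
apply: (@le_trans _ _ (\int[P]_(t in A) (X t ^+ 2)%:E)).
  apply: ge0_le_integral => //.
  - by move=> t _; rewrite lee_fin ltW.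
  - by apply/measurable_EFinP/measurable_funTS; exact: measurable_funX.
  - move=> t At; rewrite lee_fin -(real_normK (num_real (X t))).
    by rewrite ler_sqr ?nnegrE// ltW.
apply: ge0_subset_integral => //.
  by apply/measurable_EFinP; exact: measurable_funX.
by move=> t _; rewrite lee_fin sqr_ge0.
Qed.

Lemma integrable_product (X Y : T -> R) :
  measurable_fun setT X -> measurable_fun setT Y ->
  P.-integrable setT (fun t => (X t ^+ 2)%:E) ->
  P.-integrable setT (fun t => (Y t ^+ 2)%:E) ->
  P.-integrable setT (fun t => (X t * Y t)%:E).
Proof.
move=> mX mY iX iY; apply: (@le_integrable _ _ _ P _ measurableT _
   (fun t => (X t ^+ 2)%:E + (Y t ^+ 2)%:E)).
- by apply/measurable_EFinP; exact: measurable_funM.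
- move=> t _; rewrite -EFinD !abse_EFin lee_fin.
  rewrite [leRHS]ger0_norm ?addr_ge0 ?sqr_ge0// ler_norml.
  have := sqr_ge0 (X t + Y t); have := sqr_ge0 (X t - Y t).
  have := sqr_ge0 (X t); have := sqr_ge0 (Y t).
  by rewrite !expr2; nra.
- exact: integrableD.
Qed.

Lemma second_moment_sum (n : nat) (z : 'I_n -> {RV P >-> R}) (V : R) :
  (forall k, \int[P]_t (z k t ^+ 2)%:E <= V%:E) ->
  (forall k l, k != l -> \int[P]_t (z k t * z l t)%:E = 0) ->
  \int[P]_t ((\sum_k z k t) ^+ 2)%:E <= (n%:R * V)%:E.
Proof.
move=> zV z0.
have sqri k : P.-integrable setT (fun t => (z k t ^+ 2)%:E).
  apply/integrableP; split.
    by apply/measurable_EFinP; exact: measurable_funX.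
  under eq_integral do rewrite gee0_abs ?lee_fin ?sqr_ge0//.
  exact: le_lt_trans (zV k) (ltry _).
have prodi k l : P.-integrable setT (fun t => (z k t * z l t)%:E).
  exact: integrable_product.
have -> : \int[P]_t ((\sum_k z k t) ^+ 2)%:E =
    \int[P]_t (\sum_k \sum_l (z k t * z l t)%:E).
  apply: eq_integral => t _; rewrite expr2 mulr_suml -sumEFin.
  by apply: eq_bigr => k _; rewrite mulr_sumr -sumEFin.
rewrite integral_sum// => [|k]; last exact: integrable_sum.
rewrite mulr_natl -[X in _ <= (_ *+ X)%:E]card_ord -sumr_const -sumEFin.
apply: lee_sum => k _; rewrite integral_sum// (bigD1 k)//= big1 => [|l lk].
  by rewrite adde0; exact: zV.
by rewrite z0// eq_sym.
Qed.

End SecondMoments.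

(** * Measurability of the observed information *)

Section MeasurableInformation.
Context {R : realType} {q m : nat} d (T : measurableType d).
Variables (sx : 'I_m -> R) (se : 'I_q.+1 -> 'I_m -> R).

Lemma measurable_fun_inv (f : T -> R) : measurable_fun setT f ->
  measurable_fun setT (fun t => (f t)^-1).
Proof.
move=> mf; rewrite (_ : (fun t => _) = fun t => f t * (f t ^+ 2) `^ (-1)).
  apply: measurable_funM => //.
  by apply: (measurableT_comp (measurable_powR _)); exact: measurable_funX.
(* The exponent -1 of [powR] is the inverse on nonnegative bases, hence the
   square; at 0 both sides vanish because 0^-1 = 0. *)
apply/funext => t; rewrite powR_inv1 ?sqr_ge0//.
by have [->|f0] := eqVneq (f t) 0; rewrite ?invr0 ?mul0r//; field.
Qed.

Lemma measurable_alpha (theta : T -> 'rV[R]_(pdim q m)) i :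
  measurable_rV theta -> measurable_fun setT (fun t => alpha (theta t) i).
Proof.
by move=> mtheta; rewrite /alpha; case: unliftP => // l _; exact: mtheta.
Qed.

Lemma measurable_beta (theta : T -> 'rV[R]_(pdim q m)) i :
  measurable_rV theta -> measurable_fun setT (fun t => beta (theta t) i).
Proof.
by move=> mtheta; rewrite /beta; case: unliftP => // l _; exact: mtheta.
Qed.

Variables (theta : T -> 'rV[R]_(pdim q m)) (S : T -> 'I_q.+1 -> 'I_m -> R).
Hypotheses (mtheta : measurable_rV theta)
  (mS : forall i j, measurable_fun setT (fun t => S t i j)).

Ltac measurability := repeat lazymatch goal with
  | |- measurable_fun _ (fun t => @?f t - @?g t) => apply: measurable_funB
  | |- measurable_fun _ (fun t => @?f t + @?g t) => apply: measurable_funD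
  | |- measurable_fun _ (fun t => @?f t * @?g t) => apply: measurable_funM
  | |- measurable_fun _ (fun t => @?f t ^+ _) => apply: measurable_funX
  | |- measurable_fun _ (fun t => (@?f t)^-1) => apply: measurable_fun_inv
  | |- measurable_fun _ (fun t => \sum_i @?f t i) => apply: measurable_sum => ?
  | |- measurable_fun _ (fun t => mu (theta t) _) => exact: mtheta
  | |- measurable_fun _ (fun t => alpha (theta t) _) => exact: measurable_alpha
  | |- measurable_fun _ (fun t => beta (theta t) _) => exact: measurable_beta
  | |- measurable_fun _ (fun t => S t _ _) => exact: mS
  | |- measurable_fun _ (fun t => ?c) => exact: measurable_cst
  end.

Lemma measurable_obs_info tau k rho u v :
  measurable_fun setT (fun t => obs_info sx se tau k rho (S t) (theta t) u v).
Proof.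
have ma j : measurable_fun setT (fun t => quad_coef sx se k rho (theta t) j).
  by rewrite /quad_coef; measurability.
have ma1 w j : measurable_fun setT (fun t => quad_coef1 se rho (theta t) w j).
  by rewrite /quad_coef1; measurability.
have mb j :
    measurable_fun setT (fun t => lin_coef sx se k rho (S t) (theta t) j).
  by rewrite /lin_coef; measurability.
have mb1 w j :
    measurable_fun setT (fun t => lin_coef1 sx se k rho (S t) (theta t) w j).
  by rewrite /lin_coef1; measurability.
apply: measurable_sum => j; rewrite /obs_info_level /=; measurability;
  first [exact: ma | exact: ma1 | exact: mb | exact: mb1].
Qed.

End MeasurableInformation.

(** * Uniform approximation on events *)

Section UniformApproximation.
Context {R : realType} (T : nat -> Type) (E : forall r, set (T r)).
Arguments E : clear implicits.
Implicit Types U V : forall r, T r -> R.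

(** Each index has its own space and its own event.  The approximated functions
    are required to be bounded on the events, uniformly in all large indices,
    which makes the relation stable under products. *)
Definition unif_approx U V : Prop :=
  (exists M, \forall r \near \oo, forall t, E r t -> `|V r t| <= M) /\
  (forall eps, 0 < eps ->
     \forall r \near \oo, forall t, E r t -> `|U r t - V r t| <= eps).

Lemma eq_unif_approx U V U' V' :
  (\forall r \near \oo, forall t, U r t = U' r t) ->
  (\forall r \near \oo, forall t, V r t = V' r t) ->
  unif_approx U' V' -> unif_approx U V.
Proof.
move=> EU EV [[M B] C]; split.
  by exists M; apply: filterS2 B EV => r B EV t Et; rewrite EV; exact: B.
move=> eps /C {}C; apply: filterS (filterI (filterI EU EV) C).
by move=> r [[{}EU {}EV] {}C] t Et; rewrite EU EV; exact: C.
Qed.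

Lemma unif_approx_refl V M :
  (\forall r \near \oo, forall t, E r t -> `|V r t| <= M) -> unif_approx V V.
Proof.
move=> VM; split; first by exists M.
by move=> eps e0; near=> r => t _; rewrite subrr normr0 ltW.
Unshelve. all: by end_near. Qed.

Lemma unif_approx_seq (u : nat -> R) (l : R) : u @ \oo --> l ->
  unif_approx (fun r _ => u r) (fun _ _ => l).
Proof.
move=> ul; split; first by exists `|l|; near=> r => t _.
move=> eps e0; near=> r => t _; rewrite distrC; near: r.
by move/cvgrPdist_le : ul; exact.
Unshelve. all: by end_near. Qed.

Lemma unif_approx_cst (l : R) : unif_approx (fun _ _ => l) (fun _ _ => l).
Proof. exact: (unif_approx_seq (cvg_cst l)). Qed.

Lemma unif_approxD U1 V1 U2 V2 : unif_approx U1 V1 -> unif_approx U2 V2 ->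
  unif_approx (fun r t => U1 r t + U2 r t) (fun r t => V1 r t + V2 r t).
Proof.
move=> [[M1 B1] C1] [[M2 B2] C2]; split.
  exists (M1 + M2); apply: filterS2 B1 B2 => r B1 B2 t Et.
  by apply: le_trans (ler_normD _ _) _; apply: lerD; [exact: B1|exact: B2].
move=> eps e0; have e2 : 0 < eps / 2 by rewrite divr_gt0.
apply: filterS2 (C1 _ e2) (C2 _ e2) => r {}C1 {}C2 t Et.
rewrite (_ : _ - _ = (U1 r t - V1 r t) + (U2 r t - V2 r t)); last by ring.
apply: le_trans (ler_normD _ _) _; rewrite (splitr eps).
by apply: lerD; [exact: C1|exact: C2].
Qed.

Lemma unif_approxN U V : unif_approx U V ->
  unif_approx (fun r t => - U r t) (fun r t => - V r t).
Proof.
move=> [[M B] C]; split.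
  by exists M; apply: filterS B => r H t Et; rewrite normrN; exact: H.
move=> eps /C; apply: filterS => r H t Et.
by rewrite -opprD normrN; exact: H.
Qed.

Lemma unif_approxM U1 V1 U2 V2 : unif_approx U1 V1 -> unif_approx U2 V2 ->
  unif_approx (fun r t => U1 r t * U2 r t) (fun r t => V1 r t * V2 r t).
Proof.
move=> [[M1 B1] C1] [[M2 B2] C2]; split.
  exists (M1 * M2); apply: filterS2 B1 B2 => r B1 B2 t Et.
  by rewrite normrM; apply: ler_pM => //; [exact: B1|exact: B2].
move=> eps e0.
pose N := `|M1| + `|M2| + 1.
have N0 : 0 < N by rewrite /N; have := normr_ge0 M1; have := normr_ge0 M2; lra.
(* An error of at most 1 keeps |U1| at most [N]; an error of at most eps / (2 N)
   makes each of the two products at most eps / 2. *)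
pose dl := Num.min 1 (eps / (2 * N)).
have dl0 : 0 < dl by rewrite lt_min ltr01 divr_gt0// mulr_gt0.
have {}C1 := C1 _ dl0; have {}C2 := C2 _ dl0.
apply: filterS2 (filterI B1 B2) (filterI C1 C2).
move=> r [{}B1 {}B2] [{}C1 {}C2] t Et.
have {}B1 := B1 t Et; have {}B2 := B2 t Et.
have {}C1 := C1 t Et; have {}C2 := C2 t Et.
rewrite (_ : _ - _ = U1 r t * (U2 r t - V2 r t) + V2 r t * (U1 r t - V1 r t));
  last by ring.
have d1 : dl <= 1 by rewrite ge_min lexx.
have dN : dl * (2 * N) <= eps.
  by rewrite -ler_pdivlMr ?mulr_gt0// ge_min lexx orbT.
have HU : `|U1 r t| <= N.
  rewrite -(subrK (V1 r t) (U1 r t)); apply: le_trans (ler_normD _ _) _.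
  by have := ler_norm M1; have := normr_ge0 M2; rewrite /N; lra.
have HV : `|V2 r t| <= N.
  by have := ler_norm M2; have := normr_ge0 M1; rewrite /N; lra.
apply: le_trans (ler_normD _ _) _; rewrite !normrM.
have H1 : `|U1 r t| * `|U2 r t - V2 r t| <= N * dl by exact: ler_pM.
have H2 : `|V2 r t| * `|U1 r t - V1 r t| <= N * dl by exact: ler_pM.
by lra.
Qed.

Lemma unif_approxX U V n : unif_approx U V ->
  unif_approx (fun r t => U r t ^+ n) (fun r t => V r t ^+ n).
Proof.
move=> UV; elim: n => [|n IH]; first exact: unif_approx_cst.
apply: (eq_unif_approx _ _ (unif_approxM UV IH));
  by apply: nearW => r t; exact: exprS.
Qed.

Lemma unif_approxV U (l : R) : 0 < l -> unif_approx U (fun _ _ => l) ->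
  unif_approx (fun r t => (U r t)^-1) (fun _ _ => l^-1).
Proof.
move=> l0 [_ C]; split; first by exists `|l^-1|; near=> r => t _.
move=> eps e0.
(* An error below l / 2 keeps U above l / 2, and then
   |1/U - 1/l| <= |U - l| / (l^2 / 2). *)
have l20 : 0 < Num.min (l / 2) (eps * (l ^+ 2 / 2)).
  by rewrite lt_min divr_gt0// mulr_gt0// divr_gt0// exprn_gt0.
apply: filterS (C _ l20) => r {}C t Et; have {C} := C t Et.
rewrite le_min => /andP[/[dup] + + C2] => /ler_normlP[C1 _] _.
have lU : l / 2 <= U r t by lra.
have U0 : 0 < U r t by apply: lt_le_trans lU; rewrite divr_gt0.
rewrite (_ : _ - _ = (l - U r t) / (U r t * l)); last first.
  by field; rewrite !lt0r_neq0.
rewrite normrM distrC normfV ler_pdivrMr; last first.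
  by rewrite normr_gt0 lt0r_neq0// mulr_gt0.
apply: le_trans C2 _; rewrite ler_pM2l//.
by rewrite ger0_norm; [nra|rewrite mulr_ge0 ?ltW].
Unshelve. all: by end_near. Qed.

Lemma unif_approx_sum (I : finType) (U V : I -> forall r, T r -> R) :
  (forall i, unif_approx (U i) (V i)) ->
  unif_approx (fun r t => \sum_i U i r t) (fun r t => \sum_i V i r t).
Proof.
move=> UV; elim: (index_enum I) => [|i s IH].
  apply: (eq_unif_approx _ _ (unif_approx_cst 0));
    by apply: nearW => r t; rewrite big_nil.
by apply: (eq_unif_approx _ _ (unif_approxD (UV i) IH));
  apply: nearW => r t; rewrite big_cons.
Qed.

End UniformApproximation.

(** * The limit of the rescaled information *)

Section InformationLimit.
Context {R : realType} {q m : nat}.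
Variables (sx : 'I_m -> R) (se : 'I_q.+1 -> 'I_m -> R) (w : 'I_q.+1 -> R).
Hypotheses (hse : forall i j, 0 < se i j) (hw : forall i, 0 < w i).
Variables (T : nat -> Type) (E : forall r, set (T r)).
Arguments E : clear implicits.
Variables (kappa : nat -> R) (rho : nat -> 'I_q.+1 -> R)
  (S : forall r, T r -> 'I_q.+1 -> 'I_m -> R)
  (phi : forall r, T r -> 'rV[R]_(pdim q m))
  (theta : 'rV[R]_(pdim q m)) (x : forall r, T r -> m.-tuple R).
Hypotheses (kappa0 : kappa @ \oo --> 0)
  (rhow : forall i, (fun r => rho r i) @ \oo --> w i)
  (phi_theta : forall h, unif_approx E (fun r t => phi t ord0 h)
     (fun _ _ => theta ord0 h))
  (S_lim : forall i j, unif_approx E (fun r t => S t i j)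
     (fun r t => w i * (alpha theta i + beta theta i * tnth (x t) j))).

Let akappa : unif_approx E (fun r _ => kappa r) (fun _ _ => 0).
Proof. exact: unif_approx_seq. Qed.

Let arho i : unif_approx E (fun r _ => rho r i) (fun _ _ => w i).
Proof. exact: unif_approx_seq. Qed.

Let amu j : unif_approx E (fun r t => mu (phi t) j) (fun _ _ => mu theta j).
Proof. exact: phi_theta. Qed.

Let aalpha i :
  unif_approx E (fun r t => alpha (phi t) i) (fun _ _ => alpha theta i).
Proof.
rewrite /alpha; case: unliftP => [l _|_]; first exact: phi_theta.
exact: unif_approx_cst.
Qed.

Let abeta i :
  unif_approx E (fun r t => beta (phi t) i) (fun _ _ => beta theta i).
Proof.
rewrite /beta; case: unliftP => [l _|_]; first exact: phi_theta.
exact: unif_approx_cst.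
Qed.

Ltac approximation := repeat lazymatch goal with
  | |- unif_approx _ (fun _ _ => ?c) _ => exact: unif_approx_cst
  | |- unif_approx _ (fun r t => @?f r t + @?g r t) _ => apply: unif_approxD
  | |- unif_approx _ (fun r t => @?f r t * @?g r t) _ => apply: unif_approxM
  | |- unif_approx _ (fun r t => @?f r t ^+ _) _ => apply: unif_approxX
  | |- unif_approx _ (fun r t => - @?f r t) _ => apply: unif_approxN
  | |- unif_approx _ (fun r t => (@?f r t)^-1) _ => apply: unif_approxV
  | |- unif_approx _ (fun r t => \sum_i @?f r t i) _ =>
      apply: unif_approx_sum => ?
  | |- unif_approx _ (fun r t => mu (phi t) _) _ => exact: amu
  | |- unif_approx _ (fun r t => alpha (phi t) _) _ => exact: aalpha
  | |- unif_approx _ (fun r t => beta (phi t) _) _ => exact: abeta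
  | |- unif_approx _ (fun r t => kappa r) _ => exact: akappa
  | |- unif_approx _ (fun r t => rho r _) _ => exact: arho
  | |- unif_approx _ (fun r t => S t _ _) _ => exact: S_lim
  end.

(** The information is a rational expression in quantities that are approximated
    uniformly, and its only denominators are powers of quad_coef, whose limit is
    a positive constant because beta is 1 at the reference laboratory. *)
Lemma unif_approx_obs_info u v :
  unif_approx E
    (fun r t => obs_info sx se (kappa r) (kappa r) (rho r) (S t) (phi t) u v)
    (fun r t => limit_info sx se w theta (x t) u v).
Proof.
apply: unif_approx_sum => j.
have a0 : 0 < quad_coef sx se 0 w theta j by exact: quad_coef_limit_gt0.
have aa : unif_approx E (fun r t => quad_coef sx se (kappa r) (rho r) (phi t) j)
    (fun _ _ => quad_coef sx se 0 w theta j).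
  by rewrite /quad_coef; approximation.
have aa1 y : unif_approx E (fun r t => quad_coef1 se (rho r) (phi t) y j)
    (fun _ _ => quad_coef1 se w theta y j).
  by rewrite /quad_coef1; approximation.
have aa2 : unif_approx E (fun r t => quad_coef2 se (rho r) u v j)
    (fun _ _ => quad_coef2 se w u v j).
  by rewrite /quad_coef2; approximation.
pose S0 (y : m.-tuple R) i k := w i * (alpha theta i + beta theta i * tnth y k).
have ab : unif_approx E
    (fun r t => lin_coef sx se (kappa r) (rho r) (S t) (phi t) j)
    (fun r t => lin_coef sx se 0 w (S0 (x t)) theta j).
  by rewrite /lin_coef; approximation.
have ab1 y : unif_approx E
    (fun r t => lin_coef1 sx se (kappa r) (rho r) (S t) (phi t) y j)
    (fun r t => lin_coef1 sx se 0 w (S0 (x t)) theta y j).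
  by rewrite /lin_coef1; approximation.
have ab2 : unif_approx E (fun r t => lin_coef2 se (rho r) u v j)
    (fun _ _ => lin_coef2 se w u v j).
  by rewrite /lin_coef2; approximation.
have ar : unif_approx E (fun r t => cst_coef2 sx se (kappa r) (rho r) u v j)
    (fun _ _ => cst_coef2 sx se 0 w u v j).
  by rewrite /cst_coef2; approximation.
rewrite /obs_info_level /=; approximation;
  first [exact: aa | exact: aa1 | exact: aa2 | exact: ab | exact: ab1
        | exact: ab2 | exact: ar | by rewrite ?mulr_gt0 ?exprn_gt0].
Qed.

End InformationLimit.

(** * Deviation bounds in the model *)

Section ModelDeviations.
Context {R : realType} d (T : measurableType d) (P : probability T R).

Lemma mutually_independent_pair (K : finType) (Z : K -> T -> R) (k l : K)
    (A B : set R) : mutually_independent P Z -> k != l ->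
  measurable A -> measurable B ->
  P (Z k @^-1` A `&` Z l @^-1` B) = (P (Z k @^-1` A) * P (Z l @^-1` B))%E.
Proof.
move=> indep kl mA mB.
pose C i : set R := if i == k then A else if i == l then B else setT.
have Ck : C k = A by rewrite /C eqxx.
have Cl : C l = B by rewrite /C eq_sym (negbTE kl) eqxx.
have CT i : i != k -> i != l -> C i = setT.
  by rewrite /C => /negbTE -> /negbTE ->.
have mC i : measurable (C i) by rewrite /C; case: ifP => _ //; case: ifP.
have := indep C mC.
rewrite (bigD1 k)//= (bigD1 l)/=; last by rewrite eq_sym.
rewrite Ck Cl big1 ?mule1 => [|i /andP[ik il]]; last first.
  by rewrite CT// preimage_setT probability_setT.
move=> <-; congr (P _); apply/seteqP; split => [t [At Bt] i _|t H].
  have [->|ik] := eqVneq i k; first by rewrite Ck.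
  have [->|il] := eqVneq i l; first by rewrite Cl.
  by rewrite /= CT.
by split; [have := H k I; rewrite Ck|have := H l I; rewrite Cl].
Qed.

Context {q m : nat}.
Variables (sx : 'I_m -> R) (se : 'I_q.+1 -> 'I_m -> R) (ns : 'I_q.+1 -> nat)
  (psi : 'rV[R]_(pdim q m)) (x : 'I_m -> {RV P >-> R})
  (e : obs m ns -> {RV P >-> R}).
Hypotheses (hsx : forall j, 0 < sx j) (hse : forall i j, 0 < se i j)
  (model : calibration_model sx se psi x e).

Lemma level_deviation j (eps : R) : 0 < eps ->
  (P [set t | eps <= `|x j t - mu psi j|]%R
    <= (eps ^- 2 * normal_moment2_bound (sx j))%R%:E)%E.
Proof.
move=> e0; have mX : measurable_fun setT (fun t => x j t - mu psi j).
  exact: measurable_funB.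
apply: le_trans (markov_sqr P mX e0) _; rewrite EFinM lee_pmul2l//.
  by apply: normal_second_moment => //; exact: (law_x model).
by rewrite lte_fin invr_gt0 exprn_gt0.
Qed.

Lemma cell_deviation i j (eps : R) : 0 < eps ->
  (P [set t | eps <= `|cell_sum (fun o => e o t) i j|]%R
    <= (eps ^- 2 * ((ns i)%:R * normal_moment2_bound (se i j)))%R%:E)%E.
Proof.
move=> e0.
have mX : measurable_fun setT (fun t => cell_sum (fun o => e o t) i j).
  exact: measurable_sum.
have law k : has_normal_law (e (cell j k)) 0 (se i j) := law_e model (cell j k).
have sqr (k : 'I_(ns i)) : (\int[P]_t (e (cell j k) t ^+ 2)%:E <=
    (normal_moment2_bound (se i j))%:E)%E.
  have := normal_second_moment (hse i j) (law k).
  by under eq_integral do rewrite subr0.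
have int k := normal_integrable (hse i j) (law k).
have sqri (k : 'I_(ns i)) :
    P.-integrable setT (fun t => (e (cell j k) t ^+ 2)%:E).
  apply/integrableP; split.
    by apply/measurable_EFinP; exact: measurable_funX.
  under eq_integral do rewrite gee0_abs ?lee_fin ?sqr_ge0//.
  exact: le_lt_trans (sqr k) (ltry _).
apply: le_trans (markov_sqr P mX e0) _; rewrite EFinM lee_pmul2l//; last first.
  by rewrite lte_fin invr_gt0 exprn_gt0.
apply: (second_moment_sum (z := fun k => e (cell j k))) => // k l kl.
rewrite integral_independent_product//.
- by rewrite (normal_mean0 (hse i j) (law k)) mul0e.
- move=> A B mA mB.
  apply: (mutually_independent_pair (k := inr (cell j k)) (l := inr (cell j l))
    (indep_xe model)) => //.
  apply: contraNneq kl => -[/eqP]; rewrite eq_Tagged /= => /eqP[] ->.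
  by [].
- exact: integrable_product.
Qed.

End ModelDeviations.

(** * Measurability of the deviation events *)

Section MatrixNorm.
Context {R : realType}.

Lemma entry_le_norm (k l : nat) (A : 'M[R]_(k, l)) i j : `|A i j| <= `|A|.
Proof.
rewrite /Num.Def.normr /= mx_normrE.
by apply: (@le_bigmax _ _ _ 0 (fun ij : 'I_k * 'I_l => `|A ij.1 ij.2|) (i, j)).
Qed.

Lemma le_norm_entry (k l : nat) (A : 'M[R]_(k, l)) (eps : R) : 0 < eps ->
  eps <= `|A| <-> exists i j, eps <= `|A i j|.
Proof.
move=> e0; split=> [eA|[i [j eA]]]; last first.
  exact: le_trans eA (entry_le_norm A i j).
have A0 : mx_norm A != 0 by apply: lt0r_neq0; exact: lt_le_trans eA.
by have [[i j] Aij] := mx_norm_neq0 A0; exists i, j; rewrite -[X in _ <= X]Aij.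
Qed.

Lemma measurable_norm_ge d (T : measurableType d) (k l : nat)
    (A : T -> 'M[R]_(k, l)) (eps : R) : 0 < eps ->
  (forall i j, measurable_fun setT (fun t => A t i j)) ->
  measurable [set t | eps <= `|A t|].
Proof.
move=> e0 mA.
have -> : [set t | eps <= `|A t|] =
    \bigcup_(i in [set: 'I_k]) \bigcup_(j in [set: 'I_l])
      [set t | eps <= `|A t i j|].
  apply/seteqP; split => [t /= /(le_norm_entry _ e0)[i [j eA]]|].
    by exists i => //; exists j.
  by move=> t /= [i _ [j _ eA]]; apply/(le_norm_entry _ e0); exists i, j.
apply: fin_bigcup_measurable; first exact: finite_finset.
move=> i _; apply: fin_bigcup_measurable; first exact: finite_finset.
move=> j _; rewrite -[X in measurable X]setTI; apply: measurable_fun_le => //.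
exact: measurableT_comp.
Qed.

End MatrixNorm.

Section Sample.
Context {R : realType} {q m : nat} d (T : measurableType d)
  (P : probability T R).
Variables (sx : 'I_m -> R) (se : 'I_q.+1 -> 'I_m -> R) (ns : 'I_q.+1 -> nat)
  (psi : 'rV[R]_(pdim q m)) (x : 'I_m -> {RV P >-> R})
  (e : obs m ns -> {RV P >-> R}).

Lemma cell_sum_Y_vec t i j :
  cell_sum (observation (Y_vec psi x e t)) i j =
  (ns i)%:R * (alpha psi i + beta psi i * x j t)
  + cell_sum (fun o => e o t) i j.
Proof.
rewrite /cell_sum mulr_natl -[X in _ *+ X]card_ord -sumr_const -big_split.
by apply: eq_bigr => k _; rewrite /observation tnth_mktuple enum_rankK.
Qed.

Lemma measurable_Y_vec : measurable_fun setT (Y_vec psi x e).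
Proof.
apply/measurable_fun_tnthP => l.
rewrite (_ : _ \o _ = fun t => let o := enum_val l in
  alpha psi (lab o) + beta psi (lab o) * x (lev o) t + e o t); last first.
  by apply/funext => t /=; rewrite tnth_mktuple.
apply: measurable_funD => //; apply: measurable_funD => //.
exact: measurable_funM.
Qed.

Hypotheses (hsx : forall j, 0 < sx j) (hse : forall i j, 0 < se i j).

Lemma measurable_J (phi : #|{: obs m ns}|.-tuple R -> 'rV[R]_(pdim q m)) h s :
  measurable_rV phi -> measurable_fun setT (fun t =>
    J sx se (Y_vec psi x e t) (phi (Y_vec psi x e t)) h s).
Proof.
move=> mphi; under eq_fun do rewrite J_obs_infoE//.
apply: (@measurable_obs_info _ _ _ _ _ sx se (fun t => phi (Y_vec psi x e t))
  (fun t => cell_sum (observation (Y_vec psi x e t)))).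
  move=> l; apply: (measurableT_comp (mphi l)); exact: measurable_Y_vec.
move=> i j; under eq_fun do rewrite cell_sum_Y_vec.
apply: measurable_funD; last exact: measurable_sum.
apply: measurable_funM => //; apply: measurable_funD => //.
exact: measurable_funM.
Qed.

End Sample.

Lemma measurable_limit_info (R : realType) (q m : nat) (sx : 'I_m -> R)
    (se : 'I_q.+1 -> 'I_m -> R) (w : 'I_q.+1 -> R) d (T : measurableType d)
    (theta : T -> 'rV[R]_(pdim q m)) (x : T -> m.-tuple R) u v :
  measurable_rV theta -> measurable_fun setT x ->
  measurable_fun setT (fun t => limit_info sx se w (theta t) (x t) u v).
Proof.
move=> mtheta mx; apply: (@measurable_obs_info _ _ _ _ _ sx se theta
  (fun t i j => w i * (alpha (theta t) i + beta (theta t) i * tnth (x t) j)))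
  => // i j.
apply: measurable_funM => //; apply: measurable_funD.
  exact: measurable_alpha.
apply: measurable_funM; first exact: measurable_beta.
by apply: (measurableT_comp (measurable_tnth j)).
Qed.

Lemma measurable_limit_info_mx (R : realType) (q m : nat) (sx : 'I_m -> R)
    (se : 'I_q.+1 -> 'I_m -> R) (w : 'I_q.+1 -> R) :
  @measurable_W R (pdim q m) m (limit_info_mx sx se w).
Proof.
move=> h s.
rewrite (_ : (fun z => _) = fun z : (pdim q m).-tuple R * m.-tuple R =>
  limit_info sx se w (\row_l tnth z.1 l) z.2
    (delta_mx ord0 h) (delta_mx ord0 s));
  last by apply/funext => z; rewrite mxE.
apply: measurable_limit_info => // l.
under eq_fun do rewrite mxE.
exact: (measurableT_comp (measurable_tnth l)).
Qed.

Lemma measure_exists_le_sum d (T : measurableType d) (R : realType)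
    (P : {measure set T -> \bar R}) (I : finType) (B : I -> set T) :
  (forall i, measurable (B i)) ->
  measurable [set t | exists i, B i t] /\
  (P [set t | exists i, B i t] <= \sum_i P (B i))%E.
Proof.
move=> mB.
suff H (s : seq I) : measurable [set t | exists2 i, i \in s & B i t] /\
    (P [set t | exists2 i, i \in s & B i t] <= \sum_(i <- s) P (B i))%E.
  have [] := H (index_enum I); rewrite (_ : [set t | exists2 i, _ & _] =
    [set t | exists i, B i t])//.
  apply/seteqP; split => t /= [i]; first by move=> _ Bi; exists i.
  by exists i => //; exact: mem_index_enum.
elim: s => [|i s [mU IH]].
  rewrite (_ : [set t | _] = set0); first by rewrite big_nil measure0.
  by apply/seteqP; split => t //= [].
rewrite (_ : [set t | _] = B i `|` [set t | exists2 i, i \in s & B i t]).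
  split; first exact: measurableU.
  by rewrite big_cons; apply: le_trans (measureU2 _ _ _) _ => //; exact: leeD.
apply/seteqP; split => t /=.
  by move=> [k]; rewrite inE => /predU1P[->|ks] Bk; [left|right; exists k].
move=> [Bi|[k ks Bk]]; first by exists i; rewrite ?mem_head.
by exists k; rewrite // inE ks orbT.
Qed.

(** * Convergence in probability *)

Section Convergence.
Context {R : realType} {q m : nat}.
Variables (sx : 'I_m -> R) (se : 'I_q.+1 -> 'I_m -> R) (w : 'I_q.+1 -> R).
Hypotheses (hsx : forall j, 0 < sx j) (hse : forall i j, 0 < se i j)
  (hw : forall i, 0 < w i).
Variables (theta : 'rV[R]_(pdim q m)) (ns : nat -> 'I_q.+1 -> nat).
Hypothesis large : large_samples w ns.

Let N r := size_total (ns r).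
Let kap r : R := (N r)%:R^-1.
(* [g] is n^(-1/2) and [h] is n^(-1/4).  A noise sum is called small below n h:
   then its average is below h, which tends to 0, while Chebyshev's inequality
   bounds the probability of the contrary by a constant times
   n / (n h)^2 = 1 / (n g) = g, which tends to 0 as well. *)
Let g r : R := Num.sqrt (kap r).
Let h r : R := Num.sqrt (g r).

Let N_gt0 : \forall r \near \oo, (0 < N r)%N.
Proof.
have [/cvgnyPgt/(_ 0%N) n0 _] := large ord0.
apply: filterS n0 => r n0; apply: leq_trans n0 _.
by rewrite /N /size_total (bigD1 ord0)//= leq_addr.
Qed.

Let kap_cvg : kap @ \oo --> 0.
Proof.
apply/cvgrPdist_le => eps e0.
have [/cvgnyPgt/(_ (Num.truncn eps^-1).+1) n0 _] := large ord0.
apply: filterS2 n0 N_gt0 => r n0 N0.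
rewrite sub0r normrN ger0_norm ?invr_ge0// /kap invf_ple ?posrE ?ltr0n//.
apply: le_trans (ltW (truncnS_gt _)) _; rewrite ler_nat.
apply: leq_trans (ltnW n0) _.
by rewrite /N /size_total (bigD1 ord0)//= leq_addr.
Qed.

Let sqrt_cvg0 : (fun y : R => Num.sqrt y) @ (0 : R) --> (0 : R).
Proof. by have := @sqrt_continuous R 0; rewrite /continuous_at sqrtr0. Qed.

Let g_cvg : g @ \oo --> 0.
Proof.
apply: (@cvg_comp _ _ _ kap (fun y : R => Num.sqrt y)); first exact: kap_cvg.
exact: sqrt_cvg0.
Qed.

Let h_cvg : h @ \oo --> 0.
Proof.
apply: (@cvg_comp _ _ _ g (fun y : R => Num.sqrt y)); first exact: g_cvg.
exact: sqrt_cvg0.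
Qed.

Lemma in_B_unif_approx (T : nat -> Type) (E : forall r, set (T r)) (c : R)
    (f : forall r, T r -> 'rV[R]_(pdim q m)) :
  0 < c -> (forall r t, in_B c (N r) theta (f r t)) ->
  forall l, unif_approx E (fun r t => f r t ord0 l) (fun _ _ => theta ord0 l).
Proof.
move=> c0 fB l; split; first by exists `|theta ord0 l|; near=> r => t _.
move=> eps e0; have ec : 0 < eps / c by rewrite divr_gt0.
have /cvgrPdist_le/(_ _ ec) := g_cvg.
apply: filterS2 N_gt0 => r N0.
rewrite sub0r normrN ger0_norm ?sqrtr_ge0// => gr t _.
have -> : f r t ord0 l - theta ord0 l = (f r t - theta) ord0 l by rewrite !mxE.
apply: le_trans (entry_le_norm _ _ _) _.
have s0 : 0 < Num.sqrt ((N r)%:R : R) by rewrite sqrtr_gt0 ltr0n.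
have := fB r t; rewrite /in_B mulrC -ler_pdivlMr// => /le_trans; apply.
rewrite -(sqrtrV _) in gr *.
by rewrite mulrC -ler_pdivlMr.
Unshelve. all: by end_near. Qed.

Variables (d : nat -> measure_display) (T : forall r, measurableType (d r))
  (P : forall r, probability (T r) R).
Variables (c : R) (psi : nat -> 'rV[R]_(pdim q m))
  (phi : forall r, #|{: obs m (ns r)}|.-tuple R -> 'rV[R]_(pdim q m))
  (x : forall r, 'I_m -> {RV (P r) >-> R})
  (e : forall r, obs m (ns r) -> {RV (P r) >-> R}).
Arguments phi : clear implicits.
Arguments e : clear implicits.
Hypotheses (c0 : 0 < c) (psiB : forall r, in_B c (N r) theta (psi r))
  (phiR : forall r, in_R c (N r) theta (phi r))
  (model : forall r, calibration_model sx se (psi r) (x r) (e r)).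

Let Y r t := Y_vec (psi r) (x r) (e r) t.

Let good (K : R) r : set (T r) := [set t |
  (forall j, `|x r j t - mu (psi r) j| < K) /\
  (forall i j, `|cell_sum (fun o => e r o t) i j| < (N r)%:R * h r)].

Let psi_approx (K : R) l :
  unif_approx (good K) (fun r _ => psi r ord0 l) (fun _ _ => theta ord0 l).
Proof.
apply: (@in_B_unif_approx T (good K) c (fun r _ => psi r) c0) => r t.
exact: psiB.
Qed.

Let phi_approx (K : R) l :
  unif_approx (good K) (fun r t => phi r (Y t) ord0 l) (fun _ _ => theta ord0 l).
Proof.
apply: (@in_B_unif_approx T (good K) c (fun r t => phi r (Y t)) c0) => r t.
exact: (phiR r).2.
Qed.

Let x_bounded (K : R) j : 0 < K ->
  unif_approx (good K) (fun r t => x r j t) (fun r t => x r j t).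
Proof.
move=> K0; apply: (unif_approx_refl (M := K + (`|mu theta j| + 1))).
have [_ /(_ 1 ltr01)] := psi_approx K (lshift (q + q) j).
apply: filterS => r H t Et; rewrite -(subrK (mu (psi r) j) (x r j t)).
apply: le_trans (ler_normD _ _) (lerD (ltW (Et.1 j)) _).
rewrite -(subrK (mu theta j) (mu (psi r) j)) addrC.
apply: le_trans (ler_normD _ _) _; rewrite lerD2l.
exact: H Et.
Qed.

Let noise_vanishes (K : R) i j : unif_approx (good K)
  (fun r t => kap r * cell_sum (fun o => e r o t) i j) (fun _ _ => 0).
Proof.
split; first by exists 0; apply: nearW => r t _; rewrite normr0.
move=> eps e0; move/cvgrPdist_le : h_cvg => /(_ _ e0).
apply: filterS2 N_gt0 => r N0.
rewrite sub0r normrN ger0_norm ?sqrtr_ge0// => hr t Et.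
have k0 : 0 < kap r by rewrite invr_gt0 ltr0n.
rewrite subr0 normrM (gtr0_norm k0); apply: le_trans hr.
by rewrite mulrC -ler_pdivlMr// invrK mulrC ltW// Et.2.
Qed.

Let rho r i : R := kap r * (ns r i)%:R.

Let rho_cvg i : (fun r => rho r i) @ \oo --> w i.
Proof. by under eq_fun do rewrite /rho mulrC; have [] := large i. Qed.

Let statistics_approx (K : R) i j : 0 < K -> unif_approx (good K)
  (fun r t => kap r * cell_sum (observation (Y t)) i j)
  (fun r t => w i * (alpha theta i + beta theta i * tnth (x_vec (x r) t) j)).
Proof.
move=> K0.
have aa : unif_approx (good K)
    (fun r _ => alpha (psi r) i) (fun _ _ => alpha theta i).
  rewrite /alpha; case: unliftP => [l _|_]; first exact: psi_approx.
  exact: unif_approx_cst.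
have ab : unif_approx (good K)
    (fun r _ => beta (psi r) i) (fun _ _ => beta theta i).
  rewrite /beta; case: unliftP => [l _|_]; first exact: psi_approx.
  exact: unif_approx_cst.
apply: (eq_unif_approx
  (U' := fun r t => rho r i * (alpha (psi r) i + beta (psi r) i * x r j t)
                    + kap r * cell_sum (fun o => e r o t) i j)
  (V' := fun r t => w i * (alpha theta i + beta theta i * x r j t) + 0)).
- by apply: nearW => r t; rewrite /Y cell_sum_Y_vec mulrDr mulrA.
- by apply: nearW => r t; rewrite tnth_mktuple addr0.
apply: unif_approxD; last exact: noise_vanishes.
apply: unif_approxM; first exact: unif_approx_seq.
by apply: unif_approxD => //; apply: unif_approxM => //; exact: x_bounded.
Qed.

Let good_entry (K : R) a b : 0 < K -> unif_approx (good K)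
  (fun r t => (kap r *: J sx se (Y t) (phi r (Y t))) a b)
  (fun r t => limit_info_mx sx se w theta (x_vec (x r) t) a b).
Proof.
move=> K0; have H := @unif_approx_obs_info _ _ _ sx se w hse hw T (good K) kap rho
  (fun r t i j => kap r * cell_sum (observation (Y t)) i j)
  (fun r t => phi r (Y t)) theta (fun r t => x_vec (x r) t) kap_cvg rho_cvg
  (phi_approx K) (fun i j => statistics_approx i j K0)
  (delta_mx ord0 a) (delta_mx ord0 b).
apply: (eq_unif_approx _ _ H); last first.
  by apply: nearW => r t; rewrite mxE.
apply: filterS N_gt0 => r N0 t; rewrite mxE J_obs_infoE//.
have k0 : 0 < kap r by rewrite invr_gt0 ltr0n.
by rewrite -obs_infoZ// mulr1.
Qed.

(* Uniform approximation of each entry turns into an inclusion of events: from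
   some index on, the matrix norm can reach eps only outside the good event. *)
Let good_close (K eps : R) : 0 < K -> 0 < eps -> \forall r \near \oo, forall t,
  eps <= `|kap r *: J sx se (Y t) (phi r (Y t))
           - limit_info_mx sx se w theta (x_vec (x r) t)| ->
  ~ good K t.
Proof.
move=> K0 e0.
have H a b := (good_entry a b K0).2 _ (divr_gt0 e0 (ltr0Sn _ 1)).
have {}H : \forall r \near \oo, forall ab : 'I_(pdim q m) * 'I_(pdim q m),
    forall t, good K t ->
  `|(kap r *: J sx se (Y t) (phi r (Y t))) ab.1 ab.2 -
    limit_info_mx sx se w theta (x_vec (x r) t) ab.1 ab.2| <= eps / 2.
  by apply: filter_forall => -[a b]; exact: H.
apply: filterS H => r H t /(le_norm_entry _ e0)[a [b eab]] /(H (a, b)) /=.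
have subE (M1 M2 : 'M[R]_(pdim q m)) : (M1 - M2) a b = M1 a b - M2 a b
  by rewrite !mxE.
rewrite subE in eab.
by move=> /(le_trans eab); lra.
Qed.

Let Vx : R := \sum_j normal_moment2_bound (sx j).
Let Ve : R := \sum_(ij : 'I_q.+1 * 'I_m) normal_moment2_bound (se ij.1 ij.2).

Let moment2_ge0 (s : R) : 0 <= normal_moment2_bound s.
Proof.
rewrite divr_ge0 ?normal_peak_ge0// mulr_ge0 ?normal_peak_ge0//.
by rewrite mulr_ge0// sqr_ge0.
Qed.

Let badness (K : R) r : [set t | ~ good K t] `<=`
  [set t | exists j, K <= `|x r j t - mu (psi r) j|] `|`
  [set t | exists ij : 'I_q.+1 * 'I_m,
     (N r)%:R * h r <= `|cell_sum (fun o => e r o t) ij.1 ij.2|].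
Proof.
move=> t /= ng; apply: contrapT => /not_orP[nx nc]; apply: ng; split.
  by move=> j; rewrite ltNge; apply/negP => ?; apply: nx; exists j.
by move=> i j; rewrite ltNge; apply/negP => ?; apply: nc; exists (i, j).
Qed.

Let deviation_bound (K : R) r (D : set (T r)) :
  0 < K -> (0 < N r)%N -> measurable D ->
  D `<=` [set t | ~ good K t] -> (P r D <= (K ^- 2 * Vx + g r * Ve)%:E)%E.
Proof.
move=> K0 N0 mD Dg.
have k0 : 0 < kap r by rewrite invr_gt0 ltr0n.
have g0 : 0 < g r by rewrite sqrtr_gt0.
have h0 : 0 < h r by rewrite sqrtr_gt0.
have Nr0 : 0 < (N r)%:R :> R by rewrite ltr0n.
have tau0 : 0 < (N r)%:R * h r by rewrite mulr_gt0.
have mge (X : T r -> R) (y : R) : measurable_fun setT X ->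
    measurable [set t | y <= `|X t|].
  move=> mX; rewrite -[X in measurable X]setTI; apply: measurable_fun_le => //.
  exact: measurableT_comp.
have [mx Px] := @measure_exists_le_sum _ _ _ (P r) _
  (fun j => [set t | K <= `|x r j t - mu (psi r) j|])
  (fun j => mge _ _
     (measurable_funB (measurable_funPT (x r j)) (measurable_cst _))).
have [mc Pc] := @measure_exists_le_sum _ _ _ (P r) _
  (fun ij : 'I_q.+1 * 'I_m =>
    [set t | (N r)%:R * h r <= `|cell_sum (fun o => e r o t) ij.1 ij.2|])
  (fun ij => mge _ _
     (measurable_sum _ (fun k => measurable_funPT (e r (cell ij.2 k))))).
apply: le_trans (le_measure (P r) _ _ (subset_trans Dg (@badness K r))) _.
- by rewrite inE.
- by rewrite inE; exact: measurableU.
apply: le_trans (measureU2 _ mx mc) _; rewrite EFinD; apply: leeD.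
  apply: le_trans Px _; rewrite /Vx mulr_sumr -sumEFin; apply: lee_sum => j _.
  exact: level_deviation (model r) _ _ K0.
apply: le_trans Pc _; rewrite /Ve mulr_sumr -sumEFin.
apply: lee_sum => -[i j] _ /=.
apply: le_trans (cell_deviation hse (model r) i j tau0) _.
rewrite lee_fin mulrA ler_wpM2r// mulrC ler_pdivrMr ?exprn_gt0//.
have nN : (ns r i <= N r)%N by rewrite /N /size_total (bigD1 i)//= leq_addr.
have gg : g r ^+ 2 = (N r)%:R^-1 by rewrite sqr_sqrtr// ltW.
have hh : h r ^+ 2 = g r by rewrite sqr_sqrtr// ltW.
rewrite exprMn hh mulrCA -expr2 gg expr2 mulrK ?unitfE ?lt0r_neq0//.
by rewrite ler_nat.
Qed.

Let measurable_bad (eps : R) r : 0 < eps -> measurable [set t | eps <=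
  `|kap r *: J sx se (Y t) (phi r (Y t))
    - limit_info_mx sx se w theta (x_vec (x r) t)|].
Proof.
move=> e0; apply: measurable_norm_ge => // a b.
rewrite (_ : (fun t => _) = fun t =>
    kap r * J sx se (Y t) (phi r (Y t)) a b
    - limit_info sx se w theta (x_vec (x r) t)
        (delta_mx ord0 a) (delta_mx ord0 b)); last first.
  apply/funext => t.
  have subE (M1 M2 : 'M[R]_(pdim q m)) k :
      (k *: M1 - M2) a b = k * M1 a b - M2 a b.
    by rewrite !mxE.
  by rewrite subE [X in _ - X]mxE.
apply: measurable_funB.
  by apply: measurable_funM => //; apply: measurable_J => //; exact: (phiR r).1.
apply: (@measurable_limit_info _ _ _ sx se w _ _ (fun _ => theta)
  (fun t => x_vec (x r) t)) => //.
apply/measurable_fun_tnthP => j.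
by rewrite (_ : _ \o _ = x r j)//; apply/funext => t /=; rewrite tnth_mktuple.
Qed.

Theorem information_converges (eps : R) : 0 < eps ->
  (fun r => P r [set t | eps <=
     `|kap r *: J sx se (Y t) (phi r (Y t))
       - limit_info_mx sx se w theta (x_vec (x r) t)|])
  @ \oo --> 0%E.
Proof.
move=> e0; apply/fine_cvgP; split.
  by apply: nearW => r; apply: fin_num_measure; exact: measurable_bad.
apply/cvgrPdist_le => dl dl0.
have A0 : 0 <= Vx by apply: sumr_ge0.
have B0 : 0 <= Ve by apply: sumr_ge0.
(* This level makes the bound K^-2 Vx for the x_j at most dl / 2. *)
pose K := Num.sqrt (2 * (Vx + 1) / dl).
have K20 : 0 < 2 * (Vx + 1) / dl by rewrite divr_gt0// mulr_gt0// ltr_wpDl.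
have K0 : 0 < K by rewrite sqrtr_gt0.
have KA : K ^- 2 * Vx <= dl / 2.
  rewrite sqr_sqrtr ?(ltW K20)// invf_div mulrAC ler_pdivrMr; last first.
    by rewrite mulr_gt0// ltr_wpDl.
  by nra.
have dB : 0 < dl / (2 * (Ve + 1)) by rewrite divr_gt0// mulr_gt0// ltr_wpDl.
move/cvgrPdist_le : g_cvg => /(_ _ dB) gB.
apply: filterS2 (good_close K0 e0) (filterI N_gt0 gB) => r close [N0 gr].
rewrite sub0r normrN in gr *; rewrite ger0_norm ?sqrtr_ge0// in gr.
rewrite sub0r normrN ger0_norm ?fine_ge0//.
rewrite -lee_fin fineK ?fin_num_measure//; last exact: measurable_bad.
apply: le_trans (deviation_bound K0 N0 (measurable_bad r e0) close) _.
rewrite lee_fin (splitr dl) lerD//.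
move: gr; rewrite ler_pdivlMr ?mulr_gt0 ?ltr_wpDl// => gr.
by have := sqrtr_ge0 (kap r); rewrite -/(g r); nra.
Qed.

End Convergence.

(** * The theorem *)

Unset Implicit Arguments.

Theorem lemma3p1 (R : realType) (q m : nat) (hq : (2 <= q.+1)%N)
    (hm : (2 <= m)%N) (sx : 'I_m -> R) (se : 'I_q.+1 -> 'I_m -> R)
    (w : 'I_q.+1 -> R) (hsx : forall j, 0 < sx j)
    (hse : forall i j, 0 < se i j) (hw : forall i, 0 < w i) :
  exists W : 'rV[R]_(pdim q m) -> m.-tuple R -> 'M[R]_(pdim q m),
    measurable_W W /\
    forall theta : 'rV[R]_(pdim q m),
      (forall x, psd (W theta x)) /\
      forall (ns : nat -> 'I_q.+1 -> nat), large_samples w ns ->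
      forall c : R, 0 < c ->
      forall psi : nat -> 'rV[R]_(pdim q m),
        (forall r, in_B c (size_total (ns r)) theta (psi r)) ->
      forall phi : forall r, #|{: obs m (ns r)}|.-tuple R -> 'rV[R]_(pdim q m),
        (forall r, in_R c (size_total (ns r)) theta (phi r)) ->
      forall (d : nat -> measure_display) (T : forall r, measurableType (d r))
        (P : forall r, probability (T r) R)
        (x : forall r, 'I_m -> {RV (P r) >-> R})
        (e : forall r, obs m (ns r) -> {RV (P r) >-> R}),
        (forall r, calibration_model sx se (psi r) (x r) (e r)) ->
      forall eps : R, 0 < eps ->
        (fun r => P r [set t |
           let y := Y_vec (psi r) (x r) (e r) t in
           eps <= `|((size_total (ns r))%:R)^-1 *: J sx se y (phi r y)
                    - W theta (x_vec (x r) t)|]) @ \oo --> 0%E.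
Proof.
exists (limit_info_mx sx se w); split; first exact: measurable_limit_info_mx.
move=> theta; split=> [x|]; first exact: psd_limit_info_mx.
move=> ns large c c0 psi psiB phi phiR d T P x e model eps e0.
exact: (information_converges hsx hse hw large c0 psiB phiR model e0).
Qed.
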